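(* Let $\varphi\in\mathrm{Aut}(\mathbb{D})$ and let $\psi(z)=(z-w_1)^{n_1}(z-w_2)^{n_2}\cdots(z-w_k)^{n_k}$ be a polynomial, where $|w_j|=1$ and $n_j\in\mathbb{N}$ for all $j$. Then $C_\varphi$ is an automorphism of $\psi H^\infty$ if and only if $$mult_\psi(\varphi(w_j))=mult_\psi(w_j),\qquad 1\le j\le k.$$
   Context: $\mathbb{D}$ is the open unit disc in $\mathbb{C}$; $\mathrm{Aut}(\mathbb{D})$ is the set of bijective analytic self-maps of $\mathbb{D}$; each such $\varphi$ extends analytically to a neighbourhood of $\overline{\mathbb{D}}$, and $\varphi(w_j)$ for $|w_j|=1$ means the value of this extension. $H^\infty$ is the algebra of bounded analytic functions on $\mathbb{D}$; $\psi H^\infty=\{\psi f: f\in H^\infty\}$; $C_\varphi f=f\circ\varphi$. An automorphism of a (not necessarily unital or closed) algebra is a bijective, linear, multiplicative self-map of it; that $C_\varphi$ is an automorphism of $\psi H^\infty$ includes that it maps $\psi H^\infty$ into itself. $mult_\psi(w)$ is the multiplicity of $w$ as a zero of the polynomial $\psi$ (equal to $0$ if $\psi(w)\ne0$). *)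

(* Defs.v *)
From mathcomp Require Import all_boot all_order all_algebra.
From mathcomp Require Import complex.
From mathcomp Require Import all_classical all_reals all_analysis.

Set Implicit Arguments.
Unset Strict Implicit.
Unset Printing Implicit Defensive.

Import Order.TTheory GRing.Theory Num.Theory.
Import numFieldNormedType.Exports.

Local Open Scope classical_set_scope.
Local Open Scope ring_scope.
Local Open Scope complex_scope.

(* R[i]^o carries the normed-module structure of C over itself, so that
   `derivable` below is complex differentiability.  Norms and bounds are
   elements of R[i]: its order only relates numbers with equal imaginary
   parts, and the norm takes values in the nonnegative reals. *)

Definition disc (R : realType) : Type := {z : R[i]^o | `|z| < 1}.

Definition analytic_on (R : realType) (U : set R[i]^o)
    (g : R[i]^o -> R[i]^o) : Prop :=
  forall z, U z -> derivable g z 1.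

Definition analytic_disc (R : realType) (f : disc R -> R[i]^o) : Prop :=
  exists2 g : R[i]^o -> R[i]^o,
    analytic_on [set z | `|z| < 1] g & forall z : disc R, f z = g (val z).

Definition AutD (R : realType) : set (disc R -> disc R) :=
  [set phi : disc R -> disc R | bijective phi /\ analytic_disc (fun z => val (phi z))].

Definition analytic_extension (R : realType) (phi : disc R -> disc R)
    (g : R[i]^o -> R[i]^o) : Prop :=
  (exists U : set R[i]^o,
     [/\ open U, [set z | `|z| <= 1] `<=` U & analytic_on U g]) /\
  (forall z : disc R, g (val z) = val (phi z)).

(* A chosen extension; any two extensions agree on the closed unit disc, so
   its values there do not depend on the choice. *)
Definition extend (R : realType) (phi : disc R -> disc R) :
    R[i]^o -> R[i]^o :=
  get [set g : R[i]^o -> R[i]^o | analytic_extension phi g].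

Definition Hinfty (R : realType) : set (disc R -> R[i]^o) :=
  [set f : disc R -> R[i]^o | analytic_disc f /\ exists M, forall z, `|f z| <= M].

Definition mul_Hinfty (R : realType) (psi : {poly R[i]}) :
    set (disc R -> R[i]^o) :=
  [set g : disc R -> R[i]^o | exists2 f, Hinfty f & forall z, g z = psi.[val z] * f z].

Definition comp_op (R : realType) (phi : disc R -> disc R)
    (f : disc R -> R[i]^o) : disc R -> R[i]^o :=
  f \o phi.

(* The operations are the pointwise ones; A need not contain 1. *)
Definition algebra_automorphism (R : realType) (A : set (disc R -> R[i]^o))
    (T : (disc R -> R[i]^o) -> (disc R -> R[i]^o)) : Prop :=
  [/\ set_bij A A T,
      forall (a : R[i]) f g, A f -> A g -> T (a *: f + g) = a *: T f + T g
    & forall f g, A f -> A g -> T (f * g) = T f * T g].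

(* Main.v *)
(* An automorphism phi of the disc is a Moebius map g z = lam (z - al) / (1 - conj al z).
   Granting this, psi (g z) = K q(z) / (1 - conj al z)^N, where K is a nonzero constant
   and q is psi with every root w_j moved to g^-1(w_j), so that
   mult_q(w) = mult_psi(g w) on the circle.  If the multiplicities agree, then psi
   divides q and has the same size, hence psi = q, and composition with phi multiplies
   psi by a bounded analytic function with bounded inverse.  Conversely, if composition
   with phi is an automorphism then |psi o g| and |psi|, hence |q| and |psi|, are
   comparable on the disc, which forces equal multiplicities on the circle.

   Only complex differentiability is assumed, and the Moebius form is obtained from a
   mean value inequality alone: Goursat's bisection, applied to f o exp on the
   rectangles [x0, x1] x [0, 2 pi], shows that the mean of f over a circle centred at 0
   does not depend on the radius.  Applied to 1 / (f - w) the inequality gives the open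
   mapping property of injective maps, so that automorphisms are proper.  After
   normalisation f 0 = 0 and f'(0) <> 0, and the maximum principle for f(z)/z and
   z/f(z) gives |f(z)| = |z|, so f(z)/z has zero derivative and is constant on rays. *)

Require Import Defs.
From mathcomp Require Import all_boot all_order all_algebra.
From mathcomp Require Import complex.
From mathcomp Require Import all_classical all_reals all_analysis.
From mathcomp Require Import ring lra.

Import Order.TTheory GRing.Theory Num.Theory.
Import numFieldNormedType.Exports.

Local Open Scope classical_set_scope.
Local Open Scope ring_scope.
Local Open Scope complex_scope.
Import Normc.

Set Implicit Arguments.
Unset Strict Implicit.
Unset Printing Implicit Defensive.

(** * Goursat's theorem on rectangles *)

Section Goursat.
Variable R : realType.
Implicit Types (u v G H : R -> R -> R) (x y a b c d e p q : R).

(** Total differentiability of u + i v at x + i y with complex derivative p + i q, measured in the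
    sum norm. *)
Definition cauchy_riemann_at u v x y := exists p q : R,
  forall e, 0 < e -> exists2 D : R, 0 < D & forall x' y',
    `|x' - x| < D -> `|y' - y| < D ->
    `|u x' y' - (u x y + p * (x' - x) - q * (y' - y))|
      <= e * (`|x' - x| + `|y' - y|) /\
    `|v x' y' - (v x y + q * (x' - x) + p * (y' - y))|
      <= e * (`|x' - x| + `|y' - y|).

(* The integral of the closed form u dy + v dx over the boundary of
   [a, b] x [c, d], when G x is a primitive of u x and H y one of v^~ y. *)
Definition circulation G H a b c d :=
  (G b d - G b c) - (G a d - G a c) + (H c b - H c a) - (H d b - H d a).

Lemma MVT_is_derive (f df : R -> R) (a b : R) : a <= b ->
  (forall x, a <= x <= b -> is_derive x 1 f (df x)) ->
  exists2 x, a <= x <= b & f b - f a = df x * (b - a).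
Proof.
move=> ab hf.
have [x|x|x] := @MVT_segment R f df a b ab; last by rewrite in_itv; exists x.
  by rewrite in_itv /= => /andP[xa xb]; apply: hf; rewrite !ltW.
apply: derivable_within_continuous => y; rewrite in_itv /= => /hf hy.
exact: ex_derive.
Qed.

Lemma ler_norm_increment (f g df dg : R -> R) (a b B : R) : a <= b ->
  (forall x, a <= x <= b -> is_derive x 1 f (df x)) ->
  (forall x, a <= x <= b -> is_derive x 1 g (dg x)) ->
  (forall x, a <= x <= b -> `|df x - dg x| <= B) ->
  `|(f b - f a) - (g b - g a)| <= B * (b - a).
Proof.
move=> ab hf hg hB.
have hfg x : a <= x <= b -> is_derive x 1 (f - g) (df x - dg x).
  by move=> /[dup] /hf ? /hg ?; exact: is_deriveB.
have [x xab e] := MVT_is_derive ab hfg.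
have -> : (f b - f a) - (g b - g a) = (f - g) b - (f - g) a.
  by rewrite !fctE; ring.
rewrite e normrM (@ger0_norm _ (b - a)) ?subr_ge0 //.
by apply: ler_wpM2r; rewrite ?subr_ge0 // hB.
Qed.

(** The affine parts of u and v have the primitives [GA] and [HA], whose circulation vanishes
    because the x-slope of u equals the y-slope of v. What remains is the error on the four edges,
    at most [B] times the length of each. *)
Lemma circulation_small u v G H a b c d x y p q e : 0 <= e ->
  a <= x <= b -> c <= y <= d ->
  (forall s t, a <= s <= b -> c <= t <= d -> is_derive t 1 (G s) (u s t)) ->
  (forall s t, a <= s <= b -> c <= t <= d -> is_derive s 1 (H t) (v s t)) ->
  (forall s t, a <= s <= b -> c <= t <= d ->
    `|u s t - (u x y + p * (s - x) - q * (t - y))|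
      <= e * (`|s - x| + `|t - y|) /\
    `|v s t - (v x y + q * (s - x) + p * (t - y))|
      <= e * (`|s - x| + `|t - y|)) ->
  `|circulation G H a b c d| <= 2 * e * ((b - a) + (d - c)) ^+ 2.
Proof.
move=> e0 xab ycd hG hH huv.
have [/andP[ax xb] /andP[cy yd]] := (xab, ycd).
have ab : a <= b by lra.
have cd : c <= d by lra.
pose GA s t := (u x y + p * (s - x)) * t - q * ((t - y) ^+ 2 / 2).
pose HA t s := (v x y + p * (t - y)) * s + q * ((s - x) ^+ 2 / 2).
have dGA (s t : R) : is_derive t 1 (GA s) (u x y + p * (s - x) - q * (t - y)).
  rewrite /GA.
  apply: is_derive_eq.
  by rewrite /GRing.scale /=; field.
have dHA (t s : R) : is_derive s 1 (HA t) (v x y + q * (s - x) + p * (t - y)).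
  rewrite /HA.
  apply: is_derive_eq.
  by rewrite /GRing.scale /=; field.
set B := e * ((b - a) + (d - c)).
have hB s t : a <= s <= b -> c <= t <= d -> e * (`|s - x| + `|t - y|) <= B.
  move=> /andP[? ?] /andP[? ?]; apply: ler_wpM2l => //.
  by apply: lerD; rewrite ler_norml; lra.
have bG s : a <= s <= b ->
    `|(G s d - G s c) - (GA s d - GA s c)| <= B * (d - c).
  move=> sab; apply: (ler_norm_increment (df := u s)
    (dg := fun t => u x y + p * (s - x) - q * (t - y))) => // t tcd.
  - exact: hG.
  - exact: le_trans (huv s t sab tcd).1 (hB s t sab tcd).
have bH t : c <= t <= d ->
    `|(H t b - H t a) - (HA t b - HA t a)| <= B * (b - a).
  move=> tcd; apply: (ler_norm_increment (df := v^~ t)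
    (dg := fun s => v x y + q * (s - x) + p * (t - y))) => // s sab.
  - exact: hH.
  - exact: le_trans (huv s t sab tcd).2 (hB s t sab tcd).
have := bG a; have := bG b; have := bH c; have := bH d.
rewrite !lexx ab cd /= => /(_ isT) h1 /(_ isT) h2 /(_ isT) h3 /(_ isT) h4.
set g1 := (X in `|X| <= _) in h1; set g2 := (X in `|X| <= _) in h2.
set g3 := (X in `|X| <= _) in h3; set g4 := (X in `|X| <= _) in h4.
have -> : circulation G H a b c d = g3 - g4 + g2 - g1.
  by rewrite /circulation /g1 /g2 /g3 /g4 /GA /HA; field.
have -> : 2 * e * ((b - a) + (d - c)) ^+ 2
          = B * (d - c) + B * (d - c) + B * (b - a) + B * (b - a).
  by rewrite /B; ring.
apply: le_trans (ler_normB _ _) _; apply: lerD => //.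
apply: le_trans (ler_normD _ _) _; apply: lerD => //.
by apply: le_trans (ler_normB _ _) _; apply: lerD.
Qed.

End Goursat.

(** * Bisection of rectangles and Goursat's theorem *)

Section Bisection.
Variable R : realType.
Implicit Types (a b c d x y : R).

Lemma bisection_point (a b : nat -> R) :
  (forall n, a n <= b n) ->
  (forall n, a n <= a n.+1) -> (forall n, b n.+1 <= b n) ->
  exists x, forall n, a n <= x <= b n.
Proof.
move=> ab ai bd.
have ai' : {homo a : n m / (n <= m)%N >-> n <= m} by exact/nondecreasing_seqP.
have bd' : {homo b : n m / (n <= m)%N >-> m <= n} by exact/nonincreasing_seqP.
have anbm n m : a n <= b m.
  apply: le_trans (ai' _ _ (leq_maxl n m)) _.
  exact: le_trans (ab _) (bd' _ _ (leq_maxr n m)).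
exists (sup (range a)) => n; apply/andP; split.
  by apply: ub_le_sup; [exists (b 0%N) => _ [m _ <-]|exists n].
by apply: ge_sup; [exists (a 0%N), 0%N|move=> _ [m _ <-]].
Qed.

Lemma halving_lt (w D : R) : 0 < D -> exists n, w / 2 ^+ n < D.
Proof.
move=> D0; exists (Num.truncn `|w / D|).+1.
rewrite ltr_pdivrMr ?exprn_gt0 // mulrC -ltr_pdivrMr //.
apply: le_lt_trans (ler_norm _) _.
apply: lt_trans (truncnS_gt _) _.
by rewrite -natrX ltr_nat ltn_expl.
Qed.

(** Compactness as an induction principle: if Q failed, some quarter would fail at every stage, and
    these nested quarters would shrink to a point where the local hypothesis is violated. It serves
    Goursat's theorem and uniform bounds on closed discs. *)
Lemma rectangle_cousin (Q : R -> R -> R -> R -> Prop) a0 b0 c0 d0 :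
  a0 <= b0 -> c0 <= d0 ->
  (forall a b c d, a0 <= a -> a <= b -> b <= b0 -> c0 <= c -> c <= d ->
     d <= d0 ->
     Q a ((a + b) / 2) c ((c + d) / 2) -> Q a ((a + b) / 2) ((c + d) / 2) d ->
     Q ((a + b) / 2) b c ((c + d) / 2) -> Q ((a + b) / 2) b ((c + d) / 2) d ->
     Q a b c d) ->
  (forall x y, a0 <= x <= b0 -> c0 <= y <= d0 -> exists2 D, 0 < D &
     forall a b c d, a0 <= a -> b <= b0 -> c0 <= c -> d <= d0 ->
       a <= x <= b -> c <= y <= d -> b - a < D -> d - c < D -> Q a b c d) ->
  Q a0 b0 c0 d0.
Proof.
move=> ab0 cd0 hsub hloc; apply: contrapT => nQ.
pose rect : Type := ((R * R) * (R * R))%type.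
pose ok (r : rect) := [/\ a0 <= r.1.1, r.1.1 <= r.1.2 & r.1.2 <= b0] /\
  [/\ c0 <= r.2.1, r.2.1 <= r.2.2 & r.2.2 <= d0].
pose Qr (r : rect) := Q r.1.1 r.1.2 r.2.1 r.2.2.
pose child (r s : rect) :=
  [/\ r.1.1 <= s.1.1, s.1.2 <= r.1.2 & s.1.2 - s.1.1 = (r.1.2 - r.1.1) / 2] /\
  [/\ r.2.1 <= s.2.1, s.2.2 <= r.2.2 & s.2.2 - s.2.1 = (r.2.2 - r.2.1) / 2].
(* Guarding the conclusion by an implication makes the statement true for every [r], so that
   [choice] gives a total function. *)
have step (r : rect) : exists s, ok r /\ ~ Qr r -> [/\ ok s, ~ Qr s & child r s].
  have [[okr nQr]|] := pselect (ok r /\ ~ Qr r); last by exists r.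
  move: r okr nQr => [[a b] [c d]] [[/= ? ? ?] [/= ? ? ?]] nQr.
  apply: contrapT => /forallNP hs; apply: nQr.
  have {}hs a1 b1 c1 d1 : ok (a1, b1, (c1, d1)) ->
      child (a, b, (c, d)) (a1, b1, (c1, d1)) -> Q a1 b1 c1 d1.
    by move=> oks chs; apply: contrapT => nQs; apply: (hs (a1, b1, (c1, d1))).
  apply: hsub => //.
  - by apply: hs; rewrite /ok /child /=; do !split; lra.
  - by apply: hs; rewrite /ok /child /=; do !split; lra.
  - by apply: hs; rewrite /ok /child /=; do !split; lra.
  - by apply: hs; rewrite /ok /child /=; do !split; lra.
have [next hnext] := choice step.
pose r n := iter n next (a0, b0, (c0, d0)).
have rP n : ok (r n) /\ ~ Qr (r n).
  elim: n => [|n /hnext[? ? _]]; last by split.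
  by split=> [|//]; split; split.
have rC n : child (r n) (r n.+1) by case/hnext : (rP n).
have [x xr] : exists x, forall n, (r n).1.1 <= x <= (r n).1.2.
  by apply: bisection_point => n; [case: (rP n) => -[[]]|case: (rC n) => -[]
    |case: (rC n) => -[]].
have [y yr] : exists y, forall n, (r n).2.1 <= y <= (r n).2.2.
  by apply: bisection_point => n; [case: (rP n) => -[_ []]|case: (rC n) => _ []
    |case: (rC n) => _ []].
have wr n : (r n).1.2 - (r n).1.1 = (b0 - a0) / 2 ^+ n.
  elim: n => [|n IH]; first by rewrite /= expr0 divr1.
  have [[_ _ ->] _] := rC n.
  by rewrite IH exprSr invfM mulrA.
have hr n : (r n).2.2 - (r n).2.1 = (d0 - c0) / 2 ^+ n.
  elim: n => [|n IH]; first by rewrite /= expr0 divr1.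
  have [_ [_ _ ->]] := rC n.
  by rewrite IH exprSr invfM mulrA.
have [D D0 hD] := hloc x y (xr 0%N) (yr 0%N).
have [n hn] := halving_lt ((b0 - a0) + (d0 - c0)) D0.
have [[[? ? ?] [? ? ?]] nQn] := rP n.
apply: nQn; apply: hD => //.
- rewrite wr; apply: le_lt_trans hn.
  by rewrite ler_wpM2r ?invr_ge0 ?exprn_ge0 // lerDl subr_ge0.
- rewrite hr; apply: le_lt_trans hn.
  by rewrite ler_wpM2r ?invr_ge0 ?exprn_ge0 // lerDr subr_ge0.
Qed.

(** The circulation is additive over the four quarters, and so is the bound 2 e (width + height)^2;
    hence the local estimate spreads to the whole rectangle, and e is arbitrary. *)
Theorem goursat (u v G H : R -> R -> R) a b c d : a <= b -> c <= d ->
  (forall s t, a <= s <= b -> c <= t <= d -> is_derive t 1 (G s) (u s t)) ->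
  (forall s t, a <= s <= b -> c <= t <= d -> is_derive s 1 (H t) (v s t)) ->
  (forall s t, a <= s <= b -> c <= t <= d -> cauchy_riemann_at u v s t) ->
  circulation G H a b c d = 0.
Proof.
move=> ab cd hG hH hCR.
set w := (b - a) + (d - c).
suff bound e : 0 < e -> `|circulation G H a b c d| <= 2 * e * w ^+ 2.
  apply/eqP; rewrite -normr_le0; apply/ler_addgt0Pr => e e0; rewrite add0r.
  have w0 : 0 < 2 * w ^+ 2 + 1 by rewrite ltr_wpDl // mulr_ge0 // sqr_ge0.
  apply: le_trans (bound (e / (2 * w ^+ 2 + 1)) _) _; first exact: divr_gt0.
  have -> : 2 * (e / (2 * w ^+ 2 + 1)) * w ^+ 2
            = e * ((2 * w ^+ 2) / (2 * w ^+ 2 + 1)) by ring.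
  by rewrite ler_piMr ?ltW // ltr_pdivrMr // mul1r ltrDl.
move=> e0.
pose Q a b c d := `|circulation G H a b c d| <= 2 * e * ((b - a) + (d - c)) ^+ 2.
apply: (@rectangle_cousin Q) => // [a1 b1 c1 d1 ? ? ? ? ? ?|x y xab ycd].
- rewrite /Q => h1 h2 h3 h4.
  have -> : circulation G H a1 b1 c1 d1 =
     circulation G H a1 ((a1 + b1) / 2) c1 ((c1 + d1) / 2) +
     circulation G H a1 ((a1 + b1) / 2) ((c1 + d1) / 2) d1 +
     circulation G H ((a1 + b1) / 2) b1 c1 ((c1 + d1) / 2) +
     circulation G H ((a1 + b1) / 2) b1 ((c1 + d1) / 2) d1.
    by rewrite /circulation; ring.
  have -> : 2 * e * ((b1 - a1) + (d1 - c1)) ^+ 2 =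
     2 * e * (((a1 + b1) / 2 - a1) + ((c1 + d1) / 2 - c1)) ^+ 2 +
     2 * e * (((a1 + b1) / 2 - a1) + (d1 - (c1 + d1) / 2)) ^+ 2 +
     2 * e * ((b1 - (a1 + b1) / 2) + ((c1 + d1) / 2 - c1)) ^+ 2 +
     2 * e * ((b1 - (a1 + b1) / 2) + (d1 - (c1 + d1) / 2)) ^+ 2.
    by field.
  by do 3![apply: le_trans (ler_normD _ _) _; apply: lerD => //].
- have [p [q /(_ e e0)[D D0 hD]]] := hCR x y xab ycd.
  exists D => // a1 b1 c1 d1 ? ? ? ? /andP[? ?] /andP[? ?] ? ?.
  apply: (@circulation_small _ u v G H _ _ _ _ x y p q) => //.
  + exact: ltW.
  + exact/andP.
  + exact/andP.
  + by move=> s t /andP[? ?] /andP[? ?]; apply: hG; lra.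
  + by move=> s t /andP[? ?] /andP[? ?]; apply: hH; lra.
  + by move=> s t /andP[? ?] /andP[? ?]; apply: hD; rewrite ltr_norml; lra.
Qed.

End Bisection.

(** * Complex derivatives *)

(** The difference quotient multiplied out by h, which includes h = 0 and is easier to combine with
    norm estimates. *)
Lemma is_derive_expansion (K : numFieldType) (f : K^o -> K^o) (x : K^o) (l : K) :
  is_derive x 1 f l <->
  forall e : K, 0 < e -> exists2 D : K, 0 < D & forall h : K, `|h| < D ->
    `|(f (h + x) : K) - f x - l * h| <= e * `|h|.
Proof.
split=> [[df <-] e e0|hl].
- have /cvgrPdist_le/(_ e e0) := df.
  rewrite near_withinE => /nbhs_ballP[D D0 hD]; exists D => // h hh.
  have [->|h0] := eqVneq h 0.
    by rewrite add0r subrr mulr0 subr0 normr0 mulr0.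
  have /= := hD h; rewrite -ball_normE /= sub0r normrN => /(_ hh h0).
  rewrite [h%:A]mulr1 /GRing.scale /= => hle.
  have -> : (f (h + x) : K) - f x - 'D_1 f x * h
            = - (('D_1 f x - h^-1 * (f (h + x) - f x)) * h).
    by rewrite mulrBl mulrAC mulVf // mul1r opprB.
  by rewrite normrN normrM ler_wpM2r.
- suff hc : h^-1 *: (f (h *: 1 + x) - f x) @[h --> (0 : K^o)^'] --> (l : K^o).
    apply: DeriveDef; first by apply/cvg_ex; exists l.
    exact/cvg_lim.
  apply/cvgrPdist_le => e e0.
  have [D D0 hD] := hl e e0.
  rewrite near_withinE; apply/nbhs_ballP; exists D => //.
  move=> h /=; rewrite -ball_normE /= sub0r normrN => hh h0.
  rewrite [h%:A]mulr1 /GRing.scale /=.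
  have -> : l - h^-1 * (f (h + x) - f x)
            = - (((f (h + x) : K) - f x - l * h) / h).
    by rewrite mulrBl mulfK // opprB mulrC.
  by rewrite normrN normrM normfV ler_pdivrMr ?normr_gt0 // hD.
Qed.

Section ComplexDerivative.
Variable R : realType.
Local Notation C := (R[i]^o).
Implicit Types (z w l : C) (x y e : R).

Lemma real_complex_pos (e : R[i]) : 0 < e -> exists2 d : R, 0 < d & e = d%:C.
Proof.
case: e => a b; rewrite ltcE /= => /andP[/eqP -> a0].
by exists a.
Qed.

Lemma normc_real (z : R[i]) : exists2 d : R, 0 <= d & `|z| = d%:C.
Proof.
by rewrite normc_def; exists (Num.sqrt (complex.Re z ^+ 2 + complex.Im z ^+ 2)).
Qed.

Lemma normc_real_complex (x : R) : `|x%:C| = `|x|%:C.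
Proof. by rewrite normc_def /= expr0n /= addr0 sqrtr_sqr. Qed.

Lemma normc_i : `|'i%C : R[i]| = 1.
Proof. by rewrite normc_def /= expr0n expr1n add0r sqrtr1. Qed.

Lemma normr_Re_le (z : R[i]) (d : R) : `|z| <= d%:C -> `|complex.Re z| <= d.
Proof. by move=> h; rewrite -lecR; apply: le_trans (normc_ge_Re z) h. Qed.

Lemma normr_Im_le (z : R[i]) (d : R) : `|z| <= d%:C -> `|complex.Im z| <= d.
Proof.
move=> h; have := @normr_Re_le (z * 'i%C) d.
by rewrite ReiNIm normrN; apply; rewrite normrM normc_i mulr1.
Qed.

Lemma normc_le_ReIm (x y : R) : `|x +i* y| <= (`|x| + `|y|)%:C.
Proof.
rewrite [x +i* y]complexE; apply: le_trans (ler_normD _ _) _.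
by rewrite normrM normc_i mul1r !normc_real_complex rmorphD.
Qed.

(** Positive elements of [R[i]] are real, so tolerance and radius can be taken in R. *)
Lemma is_deriveC_expansion (g : C -> C) z (l : R[i]) : is_derive z 1 g l <->
  forall e, 0 < e -> exists2 D : R, 0 < D & forall h : R[i], `|h| < D%:C ->
    `|(g (h + z) : R[i]) - g z - l * h| <= e%:C * `|h|.
Proof.
rewrite is_derive_expansion; split=> hl e e0.
- have e0' : (0 : R[i]) < e%:C by rewrite ltcR.
  by have [_ /real_complex_pos[D D0 ->] hD] := hl _ e0'; exists D.
- have [d d0 ->] := real_complex_pos e0.
  have [D D0 hD] := hl d d0; exists D%:C => //.
  by rewrite ltcR.
Qed.

(** The expansion with tolerance 1 bounds the increment by (|l| + 1) |h|, where l is the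
    derivative. *)
Lemma derivable_local_bound (g : C -> C) z e : derivable g z 1 -> 0 < e ->
  exists2 D : R, 0 < D & forall h : R[i], `|h| < D%:C ->
    `|(g (h + z) : R[i]) - g z| <= e%:C.
Proof.
move=> /derivableP/is_deriveC_expansion; move: ('D_1 g z) => l.
move=> /(_ 1 ltr01)[D D0 hD] e0.
have [m m0 hm] := normc_real l.
exists (Num.min D (e / (m + 1))).
  by rewrite lt_min D0 divr_gt0 // ltr_wpDl.
move=> h; have [t t0 ht] := normc_real h.
rewrite ht ltcR lt_min => /andP[tD te].
have {}hD : `|(g (h + z) : R[i]) - g z - l * h| <= t%:C.
  by have := hD h; rewrite ht ltcR mul1r; apply.
rewrite -[X in `|X|](subrK (l * h)); apply: le_trans (ler_normD _ _) _.
apply: (@le_trans _ _ (t%:C + (m * t)%:C)).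
  by apply: lerD => //; rewrite normrM hm ht rmorphM.
rewrite -rmorphD lecR; move: te; rewrite ltr_pdivlMr ?ltr_wpDl //.
by move=> /ltW; rewrite mulrDr mulr1 addrC [m * t]mulrC.
Qed.

Lemma derivable_cauchy_riemann (F : C -> C) x y : derivable F (x +i* y) 1 ->
  cauchy_riemann_at (fun s t => complex.Re (F (s +i* t)))
    (fun s t => complex.Im (F (s +i* t))) x y.
Proof.
move=> /derivableP/is_deriveC_expansion; case: ('D_1 F (x +i* y)) => p q hl.
exists p, q => e e0.
have [D D0 hD] := hl e e0.
(* The modulus is at most the sum of the coordinates, so coordinates below D / 2 stay in the disc of
   radius D. *)
exists (D / 2); first exact: divr_gt0.
move=> x' y' hx hy.
have hn := normc_le_ReIm (x' - x) (y' - y).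
have /hD : `|(x' - x) +i* (y' - y)| < D%:C.
  by apply: le_lt_trans hn _; rewrite ltcR; lra.
have -> : (x' - x) +i* (y' - y) + (x +i* y) = x' +i* y'.
  by rewrite /GRing.add /=; congr (_ +i* _); rewrite subrK.
move=> h.
have {}h := le_trans h (ler_wpM2l _ hn).
have {}h := h _; rewrite -rmorphM lecR in h.
have {}h := h (ltW e0).
move: h; case: (F (x' +i* y')) => a b; case: (F (x +i* y)) => a0 b0 h.
split.
- by apply: le_trans (normr_Re_le h); rewrite /= le_eqVlt; apply/orP; left;
    apply/eqP; congr (`|_|); ring.
- by apply: le_trans (normr_Im_le h); rewrite /= le_eqVlt; apply/orP; left;
    apply/eqP; congr (`|_|); ring.
Qed.

End ComplexDerivative.

(** * The mean value inequality *)

Section MeanValue.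
Variable R : realType.
Local Notation C := (R[i]^o).
Implicit Types (z w l : C) (x y e : R).

(** The complex exponential in real coordinates. It wraps vertical segments of length 2 pi around
    circles about 0, turning rectangles into annuli. *)
Definition expC (z : C) : C :=
  (expR (complex.Re z) * cos (complex.Im z))
    +i* (expR (complex.Re z) * sin (complex.Im z)).

Lemma normc_expC z : `|expC z| = (expR (complex.Re z))%:C.
Proof.
rewrite normc_def /= !exprMn -mulrDr cos2Dsin2 mulr1 sqrtr_sqr.
by rewrite ger0_norm ?expR_ge0.
Qed.

Lemma expCD z w : expC (z + w) = (expC z : R[i]) * expC w.
Proof.
case: z w => [a b] [c d]; rewrite /expC /= expRD cosD sinD.
by rewrite [RHS]/GRing.mul /=; congr (_ +i* _); ring.
Qed.

(** The addition formula reduces the claim to an estimate at 0, where the expansions of the real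
    functions exp, cos and sin are multiplied. *)
Lemma derivable_expC z : derivable expC z 1.
Proof.
suff h : is_derive z 1 expC (expC z) by exact: ex_derive.
apply/is_deriveC_expansion => e e0.
set E := expR (complex.Re z).
have E0 : 0 < E := expR_gt0 _.
(* At 0 the real and imaginary errors are each at most 4 e1 t, and the factor exp z has modulus [E];
   hence the divisor 8 E. *)
pose e1 := Num.min 1 (e / (E * 8)).
have e10 : 0 < e1 by rewrite lt_min ltr01 /= divr_gt0 // mulr_gt0.
have [D1 D10 h1] := (is_derive_expansion _ _ _).1 (is_derive_expR 0) _ e10.
have [D2 D20 h2] := (is_derive_expansion _ _ _).1 (is_derive_cos 0) _ e10.
have [D3 D30 h3] := (is_derive_expansion _ _ _).1 (is_derive_sin 0) _ e10.
exists (Num.min (Num.min D1 D2) (Num.min D3 (e1 / 2))).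
  by rewrite !lt_min D10 D20 D30 divr_gt0.
move=> w hw.
have [t t0 ht] := normc_real w.
move: hw; rewrite ht ltcR !lt_min => /andP[/andP[t1 t2] /andP[t3 t4]].
have := @normr_Re_le _ w t; have := @normr_Im_le _ w t; rewrite ht lexx.
case: w ht => h k ht /= /(_ isT) hk /(_ isT) hh.
have {}h1 := h1 h (le_lt_trans hh t1).
have {}h2 := h2 k (le_lt_trans hk t2).
have {}h3 := h3 k (le_lt_trans hk t3).
move: h1 h2 h3; rewrite !addr0 expR0 cos0 sin0 !oppr0 !mul0r !mul1r !subr0 ?addr0.
move=> h1 h2 h3.
have e11 : e1 <= 1 by rewrite ge_min lexx.
have e1h : e1 * `|h| <= e1 * t by rewrite ler_pM2l.
have e1k : e1 * `|k| <= e1 * t by rewrite ler_pM2l.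
have e1t : 0 <= e1 * t by rewrite mulr_ge0 // ltW.
have A1 : `|expR h - 1| <= 2 * t.
  have -> : expR h - 1 = (expR h - 1 - h) + h by ring.
  apply: le_trans (ler_normD _ _) _.
  have : e1 * t <= t by rewrite ler_piMl.
  by lra.
have A2 : 2 * t * (e1 * `|k|) <= e1 * t.
  rewrite -[leRHS]mul1r; apply: ler_pM => //; last by lra.
    by rewrite mulr_ge0.
  by rewrite mulr_ge0 // ltW.
have Re_bound : `|expR h * cos k - 1 - h| <= 4 * e1 * t.
  have -> : expR h * cos k - 1 - h
     = (expR h - 1 - h) + ((expR h - 1) * (cos k - 1) + (cos k - 1)) by ring.
  apply: le_trans (ler_normD _ _) _.
  have h5 : `|(expR h - 1) * (cos k - 1)| <= e1 * t.
    rewrite normrM; apply: le_trans (ler_pM _ _ A1 h2) _ => //.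
  by have := ler_normD ((expR h - 1) * (cos k - 1)) (cos k - 1); lra.
have Im_bound : `|expR h * sin k - k| <= 4 * e1 * t.
  have -> : expR h * sin k - k
     = (sin k - k) + ((expR h - 1) * (sin k - k) + (expR h - 1) * k) by ring.
  apply: le_trans (ler_normD _ _) _.
  have h5 : `|(expR h - 1) * (sin k - k)| <= e1 * t.
    rewrite normrM; apply: le_trans (ler_pM _ _ A1 h3) _ => //.
  have h6 : `|(expR h - 1) * k| <= e1 * t.
    rewrite normrM; apply: le_trans (ler_pM _ _ A1 hk) _ => //.
    by rewrite ler_wpM2r //; lra.
  by have := ler_normD ((expR h - 1) * (sin k - k)) ((expR h - 1) * k); lra.
have -> : (expC (h +i* k + z) : R[i]) - expC z - expC z * (h +i* k)
  = expC z * ((expR h * cos k - 1 - h) +i* (expR h * sin k - k)).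
  rewrite expCD; set X := expC z.
  have -> : (expR h * cos k - 1 - h) +i* (expR h * sin k - k)
     = (expC (h +i* k) : R[i]) - 1 - (h +i* k).
    by apply/eqP; rewrite eq_complex /= oppr0 addr0 !eqxx.
  by ring.
rewrite normrM normc_expC -/E -[e%:C * _]rmorphM.
apply: (@le_trans _ _ (E%:C * (8 * e1 * t)%:C)).
  rewrite ler_pM2l ?ltcR //; apply: le_trans (normc_le_ReIm _ _) _.
  by rewrite lecR; lra.
rewrite -rmorphM lecR mulrA ler_wpM2r //.
have : e1 <= e / (E * 8) by rewrite ge_min lexx orbT.
by rewrite ler_pdivlMr ?mulr_gt0 //; lra.
Qed.

End MeanValue.

(** * From Goursat's theorem to the mean value inequality *)

Section MeanInequality.
Variable R : realType.
Local Notation C := (R[i]^o).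
Implicit Types (z w l : C) (x y e : R).

Lemma cauchy_riemann_continuousy (u v : R -> R -> R) x y :
  cauchy_riemann_at u v x y -> {for y, continuous (u x)}.
Proof.
move=> [p [q /(_ 1 ltr01)[D D0 hD]]].
apply/cvgrPdist_le => e e0; apply/nbhs_ballP.
have q0 : 0 < `|q| + 1 by rewrite ltr_wpDl.
exists (Num.min D (e / (`|q| + 1))); first by rewrite /= lt_min D0 divr_gt0.
move=> t /=; rewrite lt_min => /andP[tD te].
have [||h _] := hD x t; first by rewrite subrr normr0.
  by rewrite distrC.
rewrite subrr mulr0 normr0 add0r mul1r addr0 in h.
rewrite distrC.
have -> : u x t - u x y = (u x t - (u x y - q * (t - y))) - q * (t - y) by ring.
apply: le_trans (ler_normB _ _) _; rewrite normrM.
move: te; rewrite ltr_pdivlMr // distrC => /ltW.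
by lra.
Qed.

(** Exchanging u with v and x with y preserves the Cauchy-Riemann form, with q replaced by - q. *)
Lemma cauchy_riemann_continuousx (u v : R -> R -> R) x y :
  cauchy_riemann_at u v x y -> {for x, continuous (v^~ y)}.
Proof.
move=> [p [q hpq]].
apply: (@cauchy_riemann_continuousy (fun s t => v t s) (fun s t => u t s) y x).
exists p, (- q) => e /hpq[D D0 hD]; exists D => // s t hs ht.
have [hu hv] := hD t s ht hs; split.
  by rewrite [`|s - y| + _]addrC; apply: le_trans hv; rewrite le_eqVlt;
    apply/orP; left; apply/eqP; congr (`|_|); rewrite /=; ring.
rewrite [`|s - y| + _]addrC; apply: le_trans hu; rewrite le_eqVlt.
by apply/orP; left; apply/eqP; congr (`|_|); rewrite /=; ring.
Qed.

(** Integration starts at a < b and f is continuous up to c > d, so that the derivative is two-sided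
    even at the endpoints b and d. *)
Lemma primitive_exists (f : R -> R) (a b c d : R) : a < b -> d < c -> b <= d ->
  (forall x, a <= x <= c -> {for x, continuous f}) ->
  forall x, b <= x <= d ->
    is_derive x 1 (fun s => \int[lebesgue_measure]_(t in `[a, s]) f t)%R (f x).
Proof.
move=> ab dc bd cf x /andP[bx xd].
have [||||hd <-] := @continuous_FTC1_closed R f a x c.
- exact: le_lt_trans dc.
- apply: continuous_compact_integrable; first exact: segment_compact.
  apply: continuous_in_subspaceT => t; rewrite inE /= in_itv /= => h.
  exact: cf.
- exact: lt_le_trans bx.
- by apply: cf; lra.
by rewrite derive1E; exact: derivableP.
Qed.

(** Goursat's theorem for f o exp equates the integrals of Re f over the circle of radius r and over
    a tiny circle. Hence Re f takes a common value on both: at most M on the first, within e of Re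
    (f 0) on the second. *)
Lemma mean_value_Re_le (f : C -> C) (r M : R) : 0 < r < 1 ->
  (forall z, `|z| < 1 -> derivable f z 1) ->
  (forall z, `|z| = r%:C -> complex.Re (f z) <= M) -> complex.Re (f 0) <= M.
Proof.
move=> /andP[r0 r1] df hM; apply/ler_addgt0Pr => e e0.
have [D D0 hD] : exists2 D : R, 0 < D & forall h : R[i], `|h| < D%:C ->
    `|(f (h + 0) : R[i]) - f 0| <= e%:C.
  by apply: derivable_local_bound => //; apply: df; rewrite normr0 ltr01.
pose F : C -> C := f \o @expC R.
pose u s t := complex.Re (F (s +i* t)).
pose v s t := complex.Im (F (s +i* t)).
have hCR s t : s < 0 -> cauchy_riemann_at u v s t.
  move=> s0; apply: derivable_cauchy_riemann.
  apply/derivable1_diffP/differentiable_comp; apply/derivable1_diffP.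
    exact: derivable_expC.
  by apply: df; rewrite normc_expC /= ltcR -expR0 ltr_expR.
pose b := ln r.
have b0 : b < 0 by rewrite /b -ln1 ltr_ln ?posrE.
(* The left edge of the rectangle maps to a circle inside the disc of radius D, where f is within e
   of f 0. *)
pose a := ln (Num.min D r / 2).
have m0 : 0 < Num.min D r / 2 by rewrite divr_gt0 // lt_min D0.
have mD : Num.min D r / 2 < D.
  by rewrite ltr_pdivrMr // gt_min ltr_pMr // ltr1n.
have mr : Num.min D r / 2 <= r.
  by rewrite ler_pdivrMr // ge_min ler_pMr // ler1n orbT.
have ab : a <= b by rewrite ler_ln ?posrE.
have pi0 : 0 < pi *+ 2 :> R by rewrite mulrn_wgt0 // pi_gt0.
pose G s t := (\int[lebesgue_measure]_(y in `[-1, t]) u s y)%R.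
pose H t s := (\int[lebesgue_measure]_(y in `[(a - 1)%R, s]) v y t)%R.
have hG s t : a <= s <= b -> 0 <= t <= pi *+ 2 -> is_derive t 1 (G s) (u s t).
  move=> /andP[_ sb]; apply: (@primitive_exists _ _ _ (pi *+ 2 + 1)) => [|||y _].
  - by rewrite oppr_lt0 ltr01.
  - by rewrite ltrDl.
  - exact: ltW.
  - exact: cauchy_riemann_continuousy (hCR s y (le_lt_trans sb b0)).
clearbody G.
have hH s t : a <= s <= b -> 0 <= t <= pi *+ 2 -> is_derive s 1 (H t) (v s t).
  move=> sab _; apply: (@primitive_exists (v^~ t) _ a (b / 2) b) => //; try lra.
  by move=> y hy; apply: cauchy_riemann_continuousx (hCR y t _); lra.
have := goursat ab (ltW pi0) hG hH _.
(* By periodicity of the exponential the two horizontal edges carry the same values, so they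
   cancel. *)
have Hper : H 0 = H (pi *+ 2).
  apply/funext => s; rewrite /H; congr (Rintegral _ _ _); apply/funext => y.
  by rewrite /v /F /= /expC /= cos0 sin0 cos2pi sin2pi.
rewrite /circulation -Hper => /(_ _)/eqP; rewrite addrK subr_eq0 => /(_ _)/eqP hab.
have {}hab : G b (pi *+ 2) - G b 0 = G a (pi *+ 2) - G a 0.
  by apply: hab => s t sab _; apply: hCR; lra.
(* The integral over a circle becomes 2 pi times the value at one of its points. *)
have mvt s : a <= s <= b -> exists2 y, 0 <= y <= pi *+ 2 &
    G s (pi *+ 2) - G s 0 = u s y * (pi *+ 2 - 0).
  move=> sab; have hGs y : 0 <= y <= pi *+ 2 -> is_derive y 1 (G s) (u s y).
    exact: hG sab.
  exact: (MVT_is_derive (ltW pi0) hGs).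
have [|ya _ ea] := mvt a; first by rewrite lexx ab.
have [|yb _ eb] := mvt b; first by rewrite ab lexx.
have uba : u b yb = u a ya.
  move: hab; rewrite eb ea ?lexx //= subr0 => /mulIf; apply.
  by rewrite gt_eqF.
have ub : u b yb <= M by apply: hM; rewrite normc_expC /= lnK.
have := hD (expC (a +i* ya)); rewrite addr0 normc_expC /= lnK ?posrE // ltcR mD.
move=> /(_ isT) /normr_Re_le; rewrite raddfB /= ler_norml.
by move: ub; rewrite uba /u /F /=; lra.
Qed.

(** Multiplying f by the unimodular constant |f 0| / f 0 makes the value at 0 real and nonnegative,
    so the bound for real parts applies. *)
Lemma mean_value_le (f : C -> C) (r M : R) : 0 < r < 1 ->
  (forall z, `|z| < 1 -> derivable f z 1) ->
  (forall z, `|z| = r%:C -> `|f z| <= M%:C) -> `|f 0| <= M%:C.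
Proof.
move=> r01 df hM.
have [d d0 fd] := normc_real (f 0); rewrite fd.
(* If f 0 = 0, it remains to see that M is nonnegative, which the point r of the circle shows. *)
have [dz|dn] := eqVneq d 0.
  rewrite dz; have /= := hM r%:C.
  rewrite normc_real_complex ger0_norm; last by case/andP: r01 => /ltW.
  by move=> /(_ erefl); apply: le_trans; rewrite normr_ge0.
have f0 : (f 0 : R[i]) != 0.
  by rewrite -normr_eq0 fd; apply: contra dn => /eqP[->].
pose c : R[i] := `|f 0| / f 0.
have c1 : `|c| = 1 by rewrite /c normrM normfV normr_id divff // normr_eq0.
have := @mean_value_Re_le (fun z => c *: f z) r M r01.
rewrite /GRing.scale /= /c divfK // fd /= lecR; apply => z hz.
  by apply: derivableZ; exact: df.
have : `|c * f z| <= M%:C by rewrite normrM c1 mul1r hM.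
by rewrite -fd -/c => /normr_Re_le; apply: le_trans (ler_norm _).
Qed.

End MeanInequality.

(** * Open mapping and properness *)

Lemma derivable_comp_field (K : numFieldType) (f g : K^o -> K^o) (z : K^o) :
  derivable f z 1 -> derivable g (f z) 1 -> derivable (g \o f) z 1.
Proof.
move=> /derivable1_diffP df /derivable1_diffP dg.
by apply/derivable1_diffP; exact: differentiable_comp.
Qed.

Section OpenMapping.
Variable R : realType.
Local Notation C := (R[i]^o).
Implicit Types (z w a : R[i]) (r s m e : R).

Lemma norm_normc z : `|z| = (normc z)%:C.
Proof. by case: z => x y; rewrite normc_def. Qed.

Lemma normc_lt z (d : R) : (`|z| < d%:C) = (normc z < d).
Proof. by rewrite norm_normc ltcR. Qed.

Lemma normc_le z (d : R) : (`|z| <= d%:C) = (normc z <= d).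
Proof. by rewrite norm_normc lecR. Qed.

Lemma normc_ge0 z : 0 <= normc z.
Proof. by rewrite -lecR -norm_normc normr_ge0. Qed.

Lemma normc_eq0 z : (normc z == 0) = (z == 0).
Proof. by apply/eqP/eqP => [/eq0_normc|->]; rewrite ?normc0. Qed.

Lemma normc_gt0 z : (0 < normc z) = (z != 0).
Proof. by rewrite lt_def normc_ge0 normc_eq0 andbT. Qed.

Lemma le_normcB z w : normc (z - w) <= normc z + normc w.
Proof. by rewrite -[normc w]normcN; exact: le_normcD. Qed.

Lemma normcB z w : normc (z - w) = normc (w - z).
Proof. by rewrite -normcN opprB. Qed.

Lemma le_normc_sub z w : normc z - normc w <= normc (z - w).
Proof. by rewrite lerBlDr -[X in normc X <= _](subrK w) le_normcD. Qed.

Lemma normcX z n : normc (z ^+ n) = normc z ^+ n.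
Proof.
by elim: n => [|n IH]; rewrite ?expr0 ?normc1 // !exprS normcM IH.
Qed.

Lemma normcR (x : R) : normc x%:C = `|x|.
Proof. by apply: complexI; rewrite -norm_normc normc_real_complex. Qed.

(** Compactness of the closed disc: [B z m] weakens as m decreases, so four local values of m are
    merged by taking their minimum. The disc is enclosed in the square of half-side r. *)
Lemma closed_disc_uniform (B : R[i] -> R -> Prop) r :
  (forall z m m', B z m -> m' <= m -> B z m') ->
  (forall z, normc z <= r -> exists2 D : R, 0 < D & exists2 m : R, 0 < m &
    forall z', normc z' <= r -> normc (z' - z) < D -> B z' m) ->
  exists2 m : R, 0 < m & forall z, normc z <= r -> B z m.
Proof.
move=> Bmono hB.
have [r0|r0] := ltP r 0.
  by exists 1 => // z /(le_trans (normc_ge0 z)); rewrite leNgt r0.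
pose Q (a b c d : R) := exists2 m : R, 0 < m & forall x y : R,
  a <= x <= b -> c <= y <= d -> normc (x +i* y) <= r -> B (x +i* y) m.
have [||||m m0 hm] := @rectangle_cousin R Q (- r) r (- r) r.
- by lra.
- by lra.
- move=> a b c d _ ab _ _ cd _ [m1 m10 h1] [m2 m20 h2] [m3 m30 h3] [m4 m40 h4].
  exists (Num.min (Num.min m1 m2) (Num.min m3 m4)).
    by rewrite !lt_min m10 m20 m30 m40.
  move=> x y xab ycd hxy.
  have [hx|/ltW hx] := leP x ((a + b) / 2); have [hy|/ltW hy] := leP y ((c + d) / 2).
  + by apply: Bmono (h1 x y _ _ hxy) _; [lra|lra|rewrite !ge_min lexx ?orbT].
  + by apply: Bmono (h2 x y _ _ hxy) _; [lra|lra|rewrite !ge_min lexx ?orbT].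
  + by apply: Bmono (h3 x y _ _ hxy) _; [lra|lra|rewrite !ge_min lexx ?orbT].
  + by apply: Bmono (h4 x y _ _ hxy) _; [lra|lra|rewrite !ge_min lexx ?orbT].
- move=> x y xr yr.
  have [hxy|hxy] := leP (normc (x +i* y)) r.
    have [D D0 [m m0 hm]] := hB _ hxy.
    exists (D / 2); first exact: divr_gt0.
    move=> a b c d _ _ _ _ xab ycd ba dc; exists m => // x' y' xab' ycd' h.
    apply: hm => //; rewrite -normc_lt.
    have -> : x' +i* y' - (x +i* y) = (x' - x) +i* (y' - y) by [].
    apply: le_lt_trans (normc_le_ReIm _ _) _; rewrite ltcR.
    have : `|x' - x| <= b - a by rewrite ler_norml; lra.
    have : `|y' - y| <= d - c by rewrite ler_norml; lra.
    by lra.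
  (* Around a point outside the disc a small rectangle misses the disc, so any m will do. *)
  exists ((normc (x +i* y) - r) / 2); first by rewrite divr_gt0 // subr_gt0.
  move=> a b c d _ _ _ _ xab ycd ba dc; exists 1 => // x' y' xab' ycd' h.
  have : normc (x' +i* y' - (x +i* y)) < normc (x +i* y) - r.
    rewrite -normc_lt.
    have -> : x' +i* y' - (x +i* y) = (x' - x) +i* (y' - y) by [].
    apply: le_lt_trans (normc_le_ReIm _ _) _; rewrite ltcR.
    have : `|x' - x| <= b - a by rewrite ler_norml; lra.
    have : `|y' - y| <= d - c by rewrite ler_norml; lra.
    by lra.
  by have := le_normc_sub (x +i* y) (x' +i* y'); rewrite normcB; lra.
exists m => // -[x y] hz; apply: hm => //.
  have := @normr_Re_le _ (x +i* y) r; rewrite normc_le => /(_ hz) /=.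
  by rewrite ler_norml.
have := @normr_Im_le _ (x +i* y) r; rewrite normc_le => /(_ hz) /=.
by rewrite ler_norml.
Qed.

Lemma derivable_affine (a c z : C) : derivable (fun t : C => a + (c : R[i]) * t) z 1.
Proof.
apply: derivableD; first exact: derivable_cst.
by apply: derivableM; [exact: derivable_cst|exact: derivable_id].
Qed.

Lemma derivable_compC (f g : C -> C) (z : C) :
  derivable f z 1 -> derivable g (f z) 1 -> derivable (g \o f) z 1.
Proof. exact: derivable_comp_field. Qed.

(** Injectivity keeps f at distance at least m from f a on the circle of radius s / 2 about a. If a
    value w with |w - f a| < m / 2 were omitted, 1 / (f - w) would be at most 2 / m on that circle
    but larger at a, against the mean value inequality. *)
Lemma injective_open_mapping (f : C -> C) a s :
  (forall z, normc z < 1 -> derivable f z 1) ->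
  (forall z z', normc z < 1 -> normc z' < 1 -> f z = f z' -> z = z') ->
  0 < s -> normc a + s <= 1 ->
  exists2 m, 0 < m & forall w, normc (w - f a) < m ->
    exists2 z, normc (z - a) < s & f z = w.
Proof.
move=> df finj s0 as1.
have ball1 z : normc (z - a) < s -> normc z < 1.
  by have := le_normc_sub z a; lra.
have [m m0 hm] : exists2 m, 0 < m & forall z, normc z <= s / 2 ->
    normc z = s / 2 -> m <= normc (f (z + a) - f a).
  apply: (@closed_disc_uniform
    (fun z m => normc z = s / 2 -> m <= normc (f (z + a) - f a))).
    by move=> z m m' h h1 /h; exact: le_trans.
  move=> z zs.
  (* The bound concerns the circle only; near a point strictly inside it is vacuous. *)
  have [ze|zn] := eqVneq (normc z) (s / 2); last first.
    have lt : normc z < s / 2 by rewrite lt_neqAle zn.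
    exists (s / 2 - normc z); first by rewrite subr_gt0.
    exists 1 => // z' _ h e.
    by have := le_normc_sub z' z; rewrite e; lra.
  have za : normc (z + a - a) < s by rewrite addrK ze ltr_pdivrMr // ltr_pMr // ltr1n.
  have za0 : 0 < normc (f (z + a) - f a).
    rewrite normc_gt0 subr_eq0; apply/eqP => /finj h.
    have : z + a = a.
      by apply: h; [exact: ball1|apply: ball1; rewrite subrr normc0].
    move/eqP; rewrite -subr_eq0 addrK => /eqP z0.
    by move: ze; rewrite z0 normc0; lra.
  have [D D0 hD] := derivable_local_bound (df _ (ball1 _ za))
    (divr_gt0 za0 (ltr0Sn _ 1)).
  exists D => //; exists (normc (f (z + a) - f a) / 2); first exact: divr_gt0.
  move=> z' _ h _.
  have := hD (z' - z); rewrite normc_lt normc_le => /(_ h).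
  rewrite addrA subrK.
  have := le_normc_sub (f (z + a) - f a) (f (z' + a) - f a).
  have -> : f (z + a) - f a - (f (z' + a) - f a) = f (z + a) - f (z' + a).
    by rewrite opprB addrA subrK.
  by rewrite [normc (_ - f (z' + a))]normcB; lra.
exists (m / 2); first exact: divr_gt0.
move=> w hw; apply: contrapT => /forall2NP nw.
have nw' z : normc (z - a) < s -> (f z : R[i]) - w != 0.
  by move=> h; rewrite subr_eq0; apply/eqP; case: (nw z).
pose p (t : C) : C := a + s%:C * t.
pose g : C -> C := fun t => (f (p t) - w)^-1.
have ps t : normc t < 1 -> normc (p t - a) < s.
  by move=> t1; rewrite addrAC subrr add0r normcM normcR gtr0_norm // gtr_pMr.
have dg t : `|t| < 1 -> derivable g t 1.
  rewrite normc_lt => t1; apply: derivableV; first exact: nw' (ps _ t1).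
  apply: derivableB; last exact: derivable_cst.
  apply: (@derivable_compC p f); first exact: derivable_affine.
  by apply: df; apply: ball1; exact: ps.
have := @mean_value_le R g (1 / 2) (2 / m) _ dg.
rewrite normc_le /g /p mulr0 addr0 normcV.
have w0 : 0 < normc (f a - w).
  by rewrite normc_gt0; apply: nw'; rewrite subrr normc0.
rewrite normcB in hw.
have h2 : 2 / m < (normc (f a - w))^-1.
  by rewrite -[2 / m]invrK ltf_pV2 ?posrE ?invr_gt0 ?divr_gt0 // invfM invrK mulrC.
rewrite leNgt h2 => /(_ _ _)/negP; apply => // [|t]; first by lra.
rewrite norm_normc => /complexI t12.
rewrite normc_le normcV -[2 / m]invrK.
have hp : m <= normc (f (p t) - f a).
  have := hm (s%:C * t); rewrite normcM normcR gtr0_norm // t12 mul1r.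
  by rewrite [_ + a]addrC; apply.
have hp2 : (2 / m)^-1 <= normc (f (p t) - w).
  rewrite invfM invrK mulrC.
  have := le_normc_sub (f (p t) - f a) (w - f a).
  by rewrite opprB addrA subrK [normc (w - _)]normcB; lra.
have h0 : 0 < (2 / m)^-1 by rewrite invr_gt0 divr_gt0.
by rewrite lef_pV2 ?posrE //; exact: lt_le_trans hp2.
Qed.

(** By the open mapping property, values near w = f a have their preimages near a, away from the
    unit circle. Compactness makes this uniform: the preimage of |w| <= 1 - e lies in |z| <= 1 -
    m. *)
Lemma automorphism_proper (f : C -> C) e :
  (forall z, normc z < 1 -> derivable f z 1) ->
  (forall z z', normc z < 1 -> normc z' < 1 -> f z = f z' -> z = z') ->
  (forall w, normc w < 1 -> exists2 z, normc z < 1 & f z = w) ->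
  0 < e -> exists2 r, r < 1 & forall z, r < normc z < 1 -> 1 - e < normc (f z).
Proof.
move=> df finj fsurj e0.
have [m m0 hm] : exists2 m, 0 < m & forall w, normc w <= 1 - e ->
    forall z, normc z < 1 -> f z = w -> normc z <= 1 - m.
  apply: (@closed_disc_uniform
    (fun w m => forall z, normc z < 1 -> f z = w -> normc z <= 1 - m)).
    by move=> w m m' h mm z z1 /h; move=> /(_ z1); lra.
  move=> w w1; have [a a1 fa] : exists2 z, normc z < 1 & f z = w.
    by apply: fsurj; lra.
  pose s := (1 - normc a) / 2.
  have s0 : 0 < s by rewrite divr_gt0 // subr_gt0.
  have [|D D0 hD] := injective_open_mapping df finj s0 (a := a).
    by rewrite /s; lra.
  exists D => //; exists s => // w' _; rewrite -fa => /hD[z za fz] z' z'1 fz'.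
  have z1 : normc z < 1 by have := le_normc_sub z a; rewrite /s in za; lra.
  have -> : z' = z by apply: finj => //; rewrite fz.
  by have := le_normc_sub z a; rewrite /s in za *; lra.
exists (1 - m); first by rewrite ltrBlDr ltrDl.
move=> z /andP[z1 z2]; rewrite ltNge; apply/negP => /hm /(_ _ z2 erefl).
by rewrite leNgt z1.
Qed.

End OpenMapping.

(** * Moebius maps *)

Lemma is_derive_comp_field (K : numFieldType) (f g : K^o -> K^o) (z : K^o) (l m : K) :
  is_derive z 1 f l -> is_derive (f z) 1 g m -> is_derive z 1 (g \o f) (m * l).
Proof.
move=> df dg.
have Df : differentiable f z by apply/derivable1_diffP; exact: ex_derive.
have Dg : differentiable g (f z) by apply/derivable1_diffP; exact: ex_derive.
have Dgf : differentiable (g \o f) z by exact: differentiable_comp.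
apply: DeriveDef; first exact/derivable1_diffP.
have e : 'd f z 1 = l by rewrite -deriveE // derive_val.
rewrite (deriveE _ Dgf) (diff_comp Df Dg) /=.
apply: (etrans (congr1 ('d g (f z)) e)).
rewrite (deriv1E (f := g)); last exact: ex_derive.
by rewrite derive1E derive_val /GRing.scale /= mulrC.
Qed.

Lemma derivable_expr_field (K : numFieldType) (f : K^o -> K^o) (z : K^o) n :
  derivable f z 1 -> derivable (fun t => (f t : K) ^+ n : K^o) z 1.
Proof.
move=> df; elim: n => [|n IH].
  rewrite (_ : (fun t => _) = cst 1) //; exact: derivable_cst.
rewrite (_ : (fun t => _) = (f * (fun t => (f t : K) ^+ n : K^o))).
  exact: derivableM.
by apply/funext => t; rewrite exprS.
Qed.

Lemma derivable_div_field (K : numFieldType) (f g : K^o -> K^o) (z : K^o) :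
  (g z : K) != 0 -> derivable f z 1 -> derivable g z 1 ->
  derivable (fun t => (f t : K) / g t : K^o) z 1.
Proof. by move=> g0 df dg; apply: derivableM => //; exact: derivableV. Qed.

Section Moebius.
Variable R : realType.
Local Notation C := (R[i]^o).
Implicit Types (z w a b : R[i]) (lam al : R[i]).

Local Notation "z ^*" := (conjc z) : ring_scope.

Lemma conjcM z w : (z * w)^* = z^* * w^*.
Proof. exact: rmorphM. Qed.

Lemma conjcD z w : (z + w)^* = z^* + w^*.
Proof. exact: rmorphD. Qed.

Lemma conjcN z : (- z)^* = - z^*.
Proof. exact: rmorphN. Qed.

Lemma conjcV z : (z^-1)^* = (z^*)^-1.
Proof. exact: fmorphV. Qed.

Definition moebius lam al z : R[i] := lam * (z - al) / (1 - al^* * z).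

Lemma sqr_normcE z : normc z ^+ 2 = complex.Re z ^+ 2 + complex.Im z ^+ 2.
Proof. by case: z => x y /=; rewrite sqr_sqrtr // addr_ge0 ?sqr_ge0. Qed.

Lemma mulr_conjc z : z * z^* = (normc z ^+ 2)%:C.
Proof. by rewrite -sqr_normc norm_normc rmorphXn. Qed.

Lemma normc_conj z : normc z^* = normc z.
Proof. by apply: complexI; rewrite -!norm_normc normcJ. Qed.

Lemma unimodular_conjc lam : normc lam = 1 -> lam * lam^* = 1.
Proof. by move=> h; rewrite mulr_conjc h expr1n. Qed.

Lemma unimodular_neq0 lam : normc lam = 1 -> lam != 0.
Proof. by move=> h; rewrite -normc_gt0 h. Qed.

Lemma moebius_den_bound al z : normc z <= 1 ->
  1 - normc al <= normc (1 - al^* * z).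
Proof.
move=> z1; have := le_normc_sub 1 (al^* * z).
rewrite normc1 normcM normc_conj.
have : normc al * normc z <= normc al by rewrite ler_piMr ?normc_ge0.
by lra.
Qed.

Lemma moebius_den_neq0 al z : normc al < 1 -> normc z <= 1 ->
  1 - al^* * z != 0.
Proof.
by move=> a1 z1; rewrite -normc_gt0; have := moebius_den_bound al z1; lra.
Qed.

(** The identity behind the size estimates: it shows that a Moebius map preserves the disc and the
    circle, and how fast 1 - |g z|^2 decays at the circle. *)
Lemma moebius_defect al z :
  normc (1 - al^* * z) ^+ 2 - normc (z - al) ^+ 2
  = (1 - normc al ^+ 2) * (1 - normc z ^+ 2).
Proof. by rewrite !sqr_normcE; case: al z => a b [x y] /=; ring. Qed.

Lemma sqr_normc_moebius lam al z : normc lam = 1 -> normc al < 1 ->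
  normc z <= 1 -> 1 - normc (moebius lam al z) ^+ 2
  = (1 - normc al ^+ 2) * (1 - normc z ^+ 2) / normc (1 - al^* * z) ^+ 2.
Proof.
move=> l1 a1 z1; rewrite -moebius_defect.
rewrite /moebius !normcM normcV l1 mul1r.
have : normc (1 - al^* * z) != 0 by rewrite normc_eq0 moebius_den_neq0.
by move=> h; field.
Qed.

Lemma normc_moebius_lt1 lam al z : normc lam = 1 -> normc al < 1 ->
  normc z < 1 -> normc (moebius lam al z) < 1.
Proof.
move=> l1 a1 z1.
have := sqr_normc_moebius l1 a1 (ltW z1).
have h : normc (moebius lam al z) ^+ 2 < 1 -> normc (moebius lam al z) < 1.
  by rewrite expr_lt1 // normc_ge0.
move=> e; apply: h; rewrite -subr_gt0 e divr_gt0 ?exprn_gt0 //.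
  by rewrite mulr_gt0 // subr_gt0 expr_lt1 // normc_ge0.
by rewrite normc_gt0 moebius_den_neq0 // ltW.
Qed.

Lemma normc_moebius_eq1 lam al z : normc lam = 1 -> normc al < 1 ->
  normc z = 1 -> normc (moebius lam al z) = 1.
Proof.
move=> l1 a1 z1.
have := @sqr_normc_moebius lam al z l1 a1; rewrite z1 lexx => /(_ isT).
rewrite expr1n subrr mulr0 mul0r => /eqP; rewrite subr_eq0 eq_sym => /eqP h.
by apply/eqP; rewrite -(@pexpr_eq1 _ _ 2) ?normc_ge0 // h.
Qed.

Lemma normc_moebius_le1 lam al z : normc lam = 1 -> normc al < 1 ->
  normc z <= 1 -> normc (moebius lam al z) <= 1.
Proof.
move=> l1 a1; rewrite le_eqVlt => /orP[/eqP z1|z1].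
  by rewrite normc_moebius_eq1.
exact/ltW/normc_moebius_lt1.
Qed.

Lemma normc_mul_unimodular lam al : normc lam = 1 -> normc (- (lam * al)) = normc al.
Proof. by move=> l1; rewrite normcN normcM l1 mul1r. Qed.

Lemma defect_neq0 al : normc al < 1 -> 1 - al * al^* != 0.
Proof.
move=> a1; rewrite mulr_conjc -[1]/(1%:C) -rmorphB.
have : 0 < 1 - normc al ^+ 2 by rewrite subr_gt0 expr_lt1 // normc_ge0.
by move=> h; apply/eqP => /complexI; lra.
Qed.

(** The inverse is the Moebius map with parameters conj lam and - lam al. Conjugates are treated as
    free variables, the relation lam conj lam = 1 being inserted by hand to leave rational
    identities for [field]. *)
Lemma moebiusK lam al z : normc lam = 1 -> normc al < 1 -> normc z <= 1 ->
  moebius lam^* (- (lam * al)) (moebius lam al z) = z.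
Proof.
move=> l1 a1 z1; have := unimodular_conjc l1; have := moebius_den_neq0 a1 z1.
have := defect_neq0 a1.
rewrite /moebius conjcN conjcM.
move: (lam^*) (al^*) => lam' al' da dz ll.
have e1 : lam' * (lam * (z - al) / (1 - al' * z) - - (lam * al))
   = (1 - al * al') * z / (1 - al' * z).
  transitivity ((lam * lam') * ((1 - al * al') * z / (1 - al' * z))).
    by field.
  by rewrite ll mul1r.
have e2 : 1 - - (lam' * al') * (lam * (z - al) / (1 - al' * z))
   = (1 - al * al') / (1 - al' * z).
  transitivity (1 + (lam * lam') * (al' * (z - al) / (1 - al' * z))).
    by field.
  by rewrite ll; field.
by rewrite e1 e2; field; apply/andP.
Qed.

Lemma moebiusKV lam al z : normc lam = 1 -> normc al < 1 -> normc z <= 1 ->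
  moebius lam al (moebius lam^* (- (lam * al)) z) = z.
Proof.
move=> l1 a1 z1.
have := @moebiusK lam^* (- (lam * al)) z; rewrite conjcK mulrN opprK mulrA.
rewrite [lam^* * _]mulrC unimodular_conjc // mul1r; apply => //.
  by rewrite normc_conj.
by rewrite normc_mul_unimodular.
Qed.

Lemma moebius_sub lam al z w : normc al < 1 -> normc z <= 1 -> normc w <= 1 ->
  moebius lam al z - moebius lam al w
  = lam * (1 - al * al^*) * (z - w) / ((1 - al^* * z) * (1 - al^* * w)).
Proof.
move=> a1 z1 w1.
have := moebius_den_neq0 a1 z1; have := moebius_den_neq0 a1 w1.
by rewrite /moebius => h1 h2; field; apply/andP.
Qed.

(** The new [al] is the zero of the composition, the preimage of al1 under the inner map. The number
    [d] is lam2 times the conjugate of 1 + conj al1 lam2 al2, so their quotient is unimodular. *)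
Lemma moebius_comp lam1 al1 lam2 al2 :
  normc lam1 = 1 -> normc al1 < 1 -> normc lam2 = 1 -> normc al2 < 1 ->
  exists lam, exists al, [/\ normc lam = 1, normc al < 1 &
    forall z, normc z <= 1 ->
      moebius lam1 al1 (moebius lam2 al2 z) = moebius lam al z].
Proof.
move=> l1 a1 l2 a2.
pose al := moebius lam2^* (- (lam2 * al2)) al1.
pose d := lam2 + al1 * al2^*.
have d0 : 1 + al1^* * lam2 * al2 != 0.
  have -> : 1 + al1^* * lam2 * al2 = 1 - (- (lam2 * al2)) * al1^* by ring.
  have := @moebius_den_neq0 (- (lam2 * al2))^* al1^*.
  by rewrite conjcK !normc_conj normc_mul_unimodular //; apply => //; exact: ltW.
have l2J := unimodular_conjc l2.
have d0J : 1 + al1 * lam2^* * al2^* != 0.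
  have := d0; rewrite -conjc_eq0 conjcD !conjcM conjc1 conjcK; exact.
have dE : d = lam2 * (1 + al1 * lam2^* * al2^*).
  rewrite /d mulrDr mulr1; congr (_ + _).
  by transitivity ((lam2 * lam2^*) * (al1 * al2^*)); [rewrite l2J mul1r|ring].
have l20 := unimodular_neq0 l2.
have dn0 : d != 0 by rewrite dE mulf_neq0.
exists (lam1 * d / (1 + al1^* * lam2 * al2)), al; split.
- rewrite !normcM normcV l1 mul1r dE normcM l2 mul1r.
  have -> : 1 + al1^* * lam2 * al2 = (1 + al1 * lam2^* * al2^*)^*.
    by rewrite conjcD !conjcM conjc1 !conjcK.
  by rewrite normc_conj divff // normc_eq0.
- by apply: normc_moebius_lt1; rewrite ?normc_conj ?normc_mul_unimodular.
move=> z z1.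
have E1 := moebius_den_neq0 a2 z1.
have E2 : 1 - al1^* * moebius lam2 al2 z != 0.
  exact: moebius_den_neq0 (normc_moebius_le1 _ _ _).
have E3 : 1 - al^* * z != 0.
  apply: moebius_den_neq0 => //.
  by apply: normc_moebius_lt1; rewrite ?normc_conj ?normc_mul_unimodular.
have alE : al = (al1 + lam2 * al2) / d.
  rewrite /al /moebius conjcN conjcM opprK mulNr opprK dE.
  have -> : 1 + lam2^* * al2^* * al1 = 1 + al1 * lam2^* * al2^* by ring.
  have -> : lam2^* = lam2^-1.
    by apply: (mulfI l20); rewrite l2J mulfV.
  rewrite invfM; ring.
have alJ : al^* = (al1^* + lam2^* * al2^*) / d^*.
  by rewrite alE !conjcM conjcD conjcM conjcV.
have dJ : d^* = lam2^* * (1 + al1^* * lam2 * al2).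
  by rewrite dE !conjcM conjcD !conjcM conjc1 !conjcK.
have dJ0 : d^* != 0 by rewrite conjc_eq0.
have dJE : d^* = lam2^* + al1^* * al2 by rewrite /d conjcD conjcM conjcK.
have E3' : d^* - (al1^* + lam2^* * al2^*) * z != 0.
  have := mulf_neq0 dJ0 E3.
  by rewrite alJ mulrBr mulr1 mulrA mulrCA divff // mulr1.
rewrite /moebius alJ.
have -> : lam1 * d / (1 + al1^* * lam2 * al2) * (z - al) /
   (1 - (al1^* + lam2^* * al2^*) / d^* * z)
   = lam1 * (d * z - (al1 + lam2 * al2)) / (1 + al1^* * lam2 * al2) * d^* /
   (d^* - (al1^* + lam2^* * al2^*) * z).
  rewrite alE; field.
  by rewrite d0 dn0 dJ0 E3'.
have -> : lam1 * (d * z - (al1 + lam2 * al2)) / (1 + al1^* * lam2 * al2) * d^*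
   = lam1 * (d * z - (al1 + lam2 * al2)) * lam2^*.
  by rewrite dJ; field.
clear E3; move: E2 E3'; rewrite dJE /d /moebius.
move: (lam2^*) (al1^*) (al2^*) l2J E1 => lam2' al1' al2' l2J E1 E2 E3.
have E4 : 1 - al2' * z - al1' * (lam2 * (z - al2)) != 0.
  have := mulf_neq0 E2 E1; rewrite mulrBl mul1r.
  by rewrite -!mulrA mulVf // mulr1.
have E5 : lam2' + al1' * al2 - (al1' + lam2' * al2') * z
   = lam2' * (1 - al2' * z - al1' * (lam2 * (z - al2))).
  transitivity (lam2' - lam2' * al2' * z - (lam2 * lam2') * al1' * (z - al2)).
    by rewrite l2J; ring.
  by ring.
have l20' : lam2' != 0.
  by apply/eqP => h; move: l2J; rewrite h mulr0 => /eqP; rewrite eq_sym oner_eq0.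
rewrite E5.
have N : lam1 * (lam2 * (z - al2) / (1 - al2' * z) - al1)
  = lam1 * ((lam2 + al1 * al2') * z - (al1 + lam2 * al2)) / (1 - al2' * z).
  by field.
rewrite N.
by field; rewrite E1 E4 l20'.
Qed.

Lemma is_derive_moebius lam al (z : C) : 1 - al^* * z != 0 ->
  is_derive z 1 (moebius lam al : C -> C)
    (lam * (1 - al * al^*) / (1 - al^* * z) ^+ 2).
Proof.
move=> z0.
pose D : C -> C := fun t => 1 - al^* * t.
have dD : is_derive z 1 D (- al^*).
  rewrite /D; apply: is_derive_eq.
  by rewrite /GRing.scale /=; ring.
have dV : is_derive z 1 (fun t => (D t)^-1 : C) (- (D z) ^- 2 * (- al^*)).
  apply: DeriveDef; first by apply: derivableV => //; exact: ex_derive.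
  by rewrite deriveV // derive_val.
have dI : is_derive z 1 (fun t : C => t - al : C) 1.
  have := is_deriveB (is_derive_id z (1 : C)) (is_derive_cst (al : C) z (1 : C)).
  by rewrite subr0.
have dN : is_derive z 1 (fun t : C => lam * (t - al) : C) lam.
  have := @is_deriveZ _ _ _ _ lam _ _ _ dI; rewrite [lam *: _]mulr1; exact.
apply: is_derive_eq.
rewrite /GRing.scale /= /D; field.
exact: z0.
Qed.

End Moebius.

(** * Automorphisms of the disc *)

Section Automorphisms.
Variable R : realType.
Local Notation C := (R[i]^o).
Implicit Types (z w a b : R[i]) (r s e : R).

Local Notation "z ^*" := (conjc z) : ring_scope.

(** Here [A] stands for the real or the imaginary part; the real mean value theorem can then be
    applied to each along a segment. *)
Lemma is_derive_along_segment (f : C -> C) (p d : R[i]) (t : R) (A : R[i] -> R) :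
  (forall z w, A (z - w) = A z - A w) -> (forall z, `|A z| <= normc z) ->
  is_derive (p + t%:C * d : C) 1 f 0 ->
  is_derive t 1 (fun s : R => A (f (p + s%:C * d))) 0.
Proof.
move=> AB An /is_deriveC_expansion hf; apply/is_derive_expansion => e e0.
have K0 : 0 < normc d + 1 by rewrite ltr_wpDl // normc_ge0.
have [D D0 hD] := hf _ (divr_gt0 e0 K0).
exists (D / (normc d + 1)); first exact: divr_gt0.
move=> h; rewrite ltr_pdivlMr // => hh.
have hn : normc (h%:C * d) <= `|h| * (normc d + 1).
  by rewrite normcM normcR ler_wpM2l // lerDl.
have := hD (h%:C * d); rewrite normc_lt => /(_ (le_lt_trans hn hh)).
rewrite mul0r subr0 mul0r subr0 -AB norm_normc norm_normc -rmorphM lecR => hle.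
have -> : p + (h + t)%:C * d = h%:C * d + (p + t%:C * d).
  by rewrite rmorphD /=; ring.
apply: le_trans (An _) _; apply: le_trans hle _.
rewrite mulrAC ler_pdivrMr // -mulrA ler_pM2l //.
Qed.

Lemma zero_derive_segment (f : C -> C) (p q : R[i]) :
  (forall t : R, 0 <= t <= 1 -> is_derive (p + t%:C * (q - p) : C) 1 f 0) ->
  f q = f p.
Proof.
move=> hf.
have key (A : R[i] -> R) : (forall z w, A (z - w) = A z - A w) ->
    (forall z, `|A z| <= normc z) -> A (f q) = A (f p).
  move=> AB An.
  have [t t01|t _] := @MVT_is_derive R (fun s : R => A (f (p + s%:C * (q - p))))
    (fun=> 0) 0 1 ler01.
    exact: is_derive_along_segment AB An (hf t t01).
  have -> : p + 1%:C * (q - p) = q by rewrite mul1r addrC subrK.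
  have -> : p + 0%:C * (q - p) = p by rewrite mul0r addr0.
  by rewrite mul0r => /eqP; rewrite subr_eq0 => /eqP.
have := key (@complex.Re R); have := key (@complex.Im R).
case: (f q) (f p) => a b [c d] /= h1 h2.
rewrite h2; first rewrite h1 //.
- by move=> z w; rewrite raddfB.
- by move=> z; apply: normr_Im_le; rewrite normc_le.
- by move=> z w; rewrite raddfB.
- by move=> z; apply: normr_Re_le; rewrite normc_le.
Qed.

(** If l were nonzero, a step h with l h = t g(z) would push the value to about (1 + t) g(z), out of
    the unit circle: with tolerance |l| / 2 the error is only t / 2. *)
Lemma unimodular_derive0 (g : C -> C) z (l : R[i]) D : 0 < D ->
  (forall h, normc h < D -> normc (g (h + z)) = 1) ->
  is_derive (z : C) 1 g l -> l = 0.
Proof.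
move=> D0 g1 /is_deriveC_expansion hg.
apply/eqP; apply: contraT => l0.
have n0 : 0 < normc l by rewrite normc_gt0.
have [D' D'0 hD] := hg _ (divr_gt0 n0 (ltr0Sn _ 1)).
have gz : normc (g z) = 1 by rewrite -[z]add0r g1 // normc0.
pose t := Num.min D D' / 2 * normc l.
have m0 : 0 < Num.min D D' by rewrite lt_min D0 D'0.
have t0 : 0 < t by rewrite mulr_gt0 // divr_gt0.
pose h := t%:C * g z / l.
have nh : normc h = Num.min D D' / 2.
  by rewrite !normcM normcV normcR gz mulr1 gtr0_norm // mulfK // gt_eqF.
have hm : normc h < Num.min D D' by rewrite nh ltr_pdivrMr // ltr_pMr // ltr1n.
have [hD1 hD2] : normc h < D /\ normc h < D' by apply/andP; rewrite -lt_min.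
have := hD h; rewrite normc_lt => /(_ hD2).
have lh : l * h = t%:C * g z by rewrite /h mulrC divfK.
rewrite lh !norm_normc -rmorphM lecR nh.
have := le_normc_sub (g z + t%:C * g z) (g (h + z)).
have -> : normc (g z + t%:C * g z) = 1 + t.
  rewrite -[X in normc (X + _)]mul1r -mulrDl normcM gz mulr1 -[1]/(1%:C).
  by rewrite -rmorphD normcR ger0_norm // addr_ge0 // ltW.
rewrite g1 // normcB opprD addrA.
have -> : normc l / 2 * (Num.min D D' / 2) = t / 2 by rewrite /t; ring.
by lra.
Qed.

Lemma exists_expr_gt (q x : R) : 1 < q -> exists N, x < q ^+ N.
Proof.
move=> q1; have d0 : 0 < q - 1 by rewrite subr_gt0.
have bern N : 1 + N%:R * (q - 1) <= q ^+ N.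
  elim: N => [|N IH]; first by rewrite mul0r addr0 expr0.
  rewrite exprSr; apply: le_trans (ler_wpM2r _ IH); last by lra.
  have : 0 <= N%:R * (q - 1) ^+ 2 by rewrite mulr_ge0 // ?sqr_ge0.
  by rewrite -natr1; nra.
exists (Num.truncn `|x / (q - 1)|).+1.
apply: lt_le_trans (bern _); rewrite -ltrBlDl.
rewrite -ltr_pdivrMr //.
apply: le_lt_trans (truncnS_gt _).
apply: le_trans (ler_norm _); rewrite ler_pM2r ?invr_gt0 //.
by lra.
Qed.

(* Only the limit of g at 0 is assumed, so g ^ N is multiplied by z to get a
   function holomorphic at 0; the factor z disappears as N tends to infinity. *)
Lemma maximum_principle_punctured (g : C -> C) (l : R[i]) :
  (forall z, z != 0 -> normc z < 1 -> derivable g z 1) ->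
  g z @[z --> (0 : C)^'] --> (l : C) ->
  (forall e, 0 < e -> exists2 r, r < 1 & forall z, r < normc z < 1 ->
    normc (g z) <= 1 + e) ->
  forall z, z != 0 -> normc z < 1 -> normc (g z) <= 1.
Proof.
move=> dg gl gb a a0 a1; apply/ler_addgt0Pr => e e0.
have [r0 r01 hr0] := gb e e0.
rewrite leNgt; apply/negP => ga.
have e10 : 0 < 1 + e by rewrite addr_gt0.
(* [N] is so large that |a| |g a|^N exceeds (1 + e)^N. *)
have [|N hN] := @exists_expr_gt (normc (g a) / (1 + e)) (normc a)^-1.
  by rewrite ltr_pdivlMr // mul1r.
have na0 : 0 < normc a by rewrite normc_gt0.
pose F : C -> C := fun z => z * g z ^+ N.
have dF z : normc z < 1 -> derivable F z 1.
  move=> z1; have [->|z0] := eqVneq z 0.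
    (* At 0 the difference quotient of [F] is g^N, so the derivative there is l^N. *)
    apply/cvg_ex; exists (l ^+ N : C).
    apply: (@cvg_trans _ (g h ^+ N @[h --> (0 : C)^'])).
      apply: near_eq_cvg; rewrite near_withinE; apply: nearW => h h0.
      rewrite /F /= mul0r subr0 [h%:A]mulr1 addr0 /GRing.scale /=.
      by rewrite mulrA mulVf // mul1r.
    elim: (N) => [|n IH]; first exact: cvg_cst.
    rewrite exprS (_ : (fun h => _) = (g * (fun h => g h ^+ n))).
      exact: cvgM gl IH.
    by apply/funext => h; rewrite exprS.
  apply: derivableM; first exact: derivable_id.
  exact: derivable_expr_field (dg z z0 z1).
pose q := Num.max r0 0.
have q0 : 0 <= q by rewrite le_max lexx orbT.
have q1 : q < 1 by rewrite gt_max r01 ltr01.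
(* With this [d], the map [T] below carries the circle of radius 1 - d beyond radius q: 1 - |T z|^2
   < 2 d / (1 - |a|)^2 = 1 - q <= 1 - q^2. *)
pose d := (1 - q) * (1 - normc a) ^+ 2 / 2.
have a10 : 0 < 1 - normc a by rewrite subr_gt0.
have d0 : 0 < d by rewrite divr_gt0 // mulr_gt0 ?exprn_gt0 // subr_gt0.
have d1 : d <= 1 / 2.
  rewrite ler_pM2r // -[1 in leRHS]mulr1; apply: ler_pM => //; try lra.
    by rewrite sqr_ge0.
  by rewrite expr_le1 //; lra.
(* [T] sends 0 to a, so the mean value inequality at 0 for F o T speaks of F a. *)
pose T : C -> C := moebius 1 (- a).
have na1 : normc (- a) < 1 by rewrite normcN.
have T1 z : normc z < 1 -> normc (T z) < 1.
  by apply: normc_moebius_lt1 => //; exact: normc1.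
have Tq z : normc z = 1 - d -> q < normc (T z).
  move=> zd; have z1 : normc z <= 1 by lra.
  have h := sqr_normc_moebius (normc1 R) na1 z1.
  have den := moebius_den_bound (- a) z1.
  rewrite normcN zd in h den.
  have E0 : 0 < normc (1 - (- a)^* * z) ^+ 2.
    by rewrite exprn_gt0 //; lra.
  have E1 : (1 - normc a) ^+ 2 <= normc (1 - (- a)^* * z) ^+ 2.
    by rewrite ler_pXn2r // ?nnegrE; [exact: ltW|exact: normc_ge0].
  suff : q ^+ 2 < normc (T z) ^+ 2.
    by rewrite ltr_pXn2r // ?nnegrE // normc_ge0.
  suff : 1 - normc (T z) ^+ 2 < 1 - q ^+ 2 by lra.
  rewrite h ltr_pdivrMr //.
  have h1 : (1 - normc a ^+ 2) * (1 - (1 - d) ^+ 2) <= 1 - (1 - d) ^+ 2.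
    rewrite ler_piMl //; last by have := sqr_ge0 (normc a); lra.
    by rewrite subr_ge0 expr_le1 //; lra.
  apply: le_lt_trans h1 _.
  apply: (@lt_le_trans _ _ ((1 - q) * (1 - normc a) ^+ 2)).
    have -> : (1 - q) * (1 - normc a) ^+ 2 = 2 * d by rewrite /d; field.
    by have : 0 < d ^+ 2 by [rewrite exprn_gt0]; nra.
  apply: ler_pM => //; rewrite ?sqr_ge0 //; first by lra.
  by nra.
have dG z : `|z| < 1 -> derivable (F \o T) z 1.
  rewrite normc_lt => z1; apply: derivable_compC; last exact/dF/T1.
  apply: ex_derive; apply: is_derive_moebius.
  by apply: moebius_den_neq0 => //; exact: ltW.
have := @mean_value_le R (F \o T) (1 - d) ((1 + e) ^+ N) _ dG.
have T0 : T 0 = a.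
  by rewrite /T /moebius mulr0 subr0 divr1 mul1r opprK add0r.
rewrite normc_le /= T0 /F normcM normcX => /(_ _ _).
have h3 : (1 + e) ^+ N < normc a * normc (g a) ^+ N.
  move: hN; rewrite expr_div_n ltr_pdivlMr ?exprn_gt0 //.
  by rewrite mulrC ltr_pdivrMr // [normc a * _]mulrC.
rewrite leNgt h3 => h; suff : ~~ true by [].
apply: h => [|z]; first by lra.
rewrite norm_normc => /complexI zd.
have z1 : normc z < 1 by rewrite zd; lra.
rewrite normc_le normcM normcX -[leRHS]mul1r.
apply: ler_pM; rewrite ?normc_ge0 ?exprn_ge0 ?normc_ge0 //.
  exact/ltW/T1.
rewrite lerXn2r ?nnegrE ?normc_ge0 //; first exact: ltW.
apply: hr0; rewrite T1 // andbT; apply: le_lt_trans (Tq z zd).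
by rewrite le_max lexx.
Qed.

End Automorphisms.

(** * Classification of the disc automorphisms *)

Section DiscAutomorphism.
Variable R : realType.
Local Notation C := (R[i]^o).
Implicit Types (z w a b : R[i]) (r s e : R).

Local Notation "z ^*" := (conjc z) : ring_scope.

(** Automorphisms as total functions on C constrained only on the disc, so that derivatives and
    compositions avoid the subtype. *)
Record disc_automorphism (f : C -> C) : Prop := DiscAutomorphism {
  disc_aut_derivable : forall z, normc z < 1 -> derivable f z 1;
  disc_aut_lt1 : forall z, normc z < 1 -> normc (f z) < 1;
  disc_aut_inj : forall z w, normc z < 1 -> normc w < 1 -> f z = f w -> z = w;
  disc_aut_surj : forall w, normc w < 1 -> exists2 z, normc z < 1 & f z = w
}.

Lemma disc_automorphism_fix0 (f : C -> C) (l : R[i]) :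
  disc_automorphism f -> f 0 = 0 -> is_derive (0 : C) 1 f l -> l != 0 ->
  normc l = 1 /\ forall z, normc z < 1 -> f z = l * z.
Proof.
move=> [df f1 finj fsurj] f0 dl l0.
(* At 0 the quotient has the default value 0; below it is used only for z nonzero, together with its
   limit l at 0. *)
pose g : C -> C := fun z => f z / z.
have gl : g z @[z --> (0 : C)^'] --> (l : C).
  have [hd <-] := dl; apply: cvg_trans hd.
  apply: near_eq_cvg; rewrite near_withinE; apply: nearW => h h0.
  by rewrite /g /= [h%:A]mulr1 addr0 f0 subr0 /GRing.scale /= mulrC.
have fn0 z : z != 0 -> normc z < 1 -> (f z : R[i]) != 0.
  move=> z0 z1; apply: contra_neq z0 => fz; apply: finj => //.
    by rewrite normc0.
  by rewrite fz f0.
have dg z : z != 0 -> normc z < 1 -> derivable g z 1.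
  move=> z0 z1; have di := @derivable_id _ C z 1.
  exact: (@derivable_div_field _ f id z z0 (df z z1) di).
have g_le1 z : z != 0 -> normc z < 1 -> normc (g z) <= 1.
  apply: (maximum_principle_punctured dg gl) => e e0.
  have e1 : 0 < 1 + e by rewrite addr_gt0.
  (* Since |f z| < 1, the quotient is below 1 / |z|, hence below 1 + e in this annulus. *)
  exists (1 + e)^-1; first by rewrite invf_lt1 // ltrDl.
  move=> {}z /andP[ze z1].
  have zp : 0 < normc z by apply: lt_trans ze; rewrite invr_gt0.
  rewrite /g normcM normcV ler_pdivrMr //.
  apply: le_trans (ltW (f1 z z1)) _.
  by rewrite -ler_pdivrMl // mulr1 ltW.
have gV_le1 z : z != 0 -> normc z < 1 -> normc (g z)^-1 <= 1.
  apply: (@maximum_principle_punctured R (fun z => (g z)^-1) l^-1).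
  - move=> {}z z0 z1; apply: derivableV; last exact: dg.
    by rewrite mulf_neq0 ?invr_neq0 // fn0.
  - exact: cvgV.
  move=> e e0.
  have e1 : 0 < 1 + e by rewrite addr_gt0.
  (* Properness bounds z / f(z) near the circle; the tolerance is such that 1 - e / (1 + e) = 1 / (1
     + e). *)
  have [r r1 hr] := automorphism_proper df finj fsurj (divr_gt0 e0 e1).
  exists r => // {}z hz; have /andP[_ z1] := hz.
  have {}hr := hr _ hz.
  have e2 : 1 - e / (1 + e) = (1 + e)^-1.
    by field; rewrite gt_eqF.
  rewrite e2 in hr.
  have fp : 0 < normc (f z) by apply: lt_trans hr; rewrite invr_gt0.
  rewrite normcV /g normcM normcV invfM invrK.
  rewrite mulrC ler_pdivrMr //; apply: le_trans (ltW z1) _.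
  by rewrite -ler_pdivrMl // mulr1 ltW.
have g1 z : z != 0 -> normc z < 1 -> normc (g z) = 1.
  move=> z0 z1; apply/eqP; rewrite eq_le g_le1 //=.
  have := gV_le1 z z0 z1; rewrite normcV invf_le1 //.
  by rewrite normc_gt0 mulf_neq0 ?invr_neq0 // fn0.
have dg0 z : z != 0 -> normc z < 1 -> is_derive (z : C) 1 g 0.
  move=> z0 z1; have /derivableP dgz := dg z z0 z1.
  have m0 : 0 < Num.min (normc z) (1 - normc z).
    by rewrite lt_min normc_gt0 z0 subr_gt0.
  have := unimodular_derive0 m0 _ dgz => h; rewrite h // in dgz.
  move=> k; rewrite lt_min => /andP[k1 k2]; apply: g1.
    apply/eqP => kz; move: k1; have -> : k = - z by apply/eqP; rewrite -addr_eq0 kz.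
    by rewrite normcN ltxx.
  by have := le_normcD k z; lra.
have gE z : z != 0 -> normc z < 1 -> g z = l.
  move=> z0 z1; apply/eqP; rewrite -subr_eq0 -normc_eq0 eq_le normc_ge0 andbT.
  apply/ler_addgt0Pr => e e0; rewrite add0r.
  have /is_deriveC_expansion/(_ e e0)[D D0 hD] := dl.
  (* The factor [s] moves z along its ray to a point s z with |s z| < D, where the expansion of f at
     0 compares g with l. *)
  pose s := Num.min 1 (D / (normc z + 1)).
  have nz1 : 0 < normc z + 1 by rewrite ltr_wpDl ?normc_ge0.
  have s0 : 0 < s by rewrite lt_min ltr01 divr_gt0.
  have s1 : s <= 1 by rewrite ge_min lexx.
  have sD : s * (normc z + 1) <= D.
    by rewrite -ler_pdivlMr // ge_min lexx orbT.
  have -> : g z = g (s%:C * z).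
    apply: zero_derive_segment => t /andP[t0 t1].
    have -> : s%:C * z + t%:C * (z - s%:C * z) = (s + t * (1 - s))%:C * z.
      by rewrite rmorphD rmorphM rmorphB /=; ring.
    have st0 : 0 < s + t * (1 - s).
      by rewrite ltr_pwDl // mulr_ge0 // subr_ge0.
    have st1 : s + t * (1 - s) <= 1.
      have : t * (1 - s) <= 1 * (1 - s) by rewrite ler_wpM2r // subr_ge0.
      by lra.
    apply: dg0.
      by rewrite -normc_gt0 normcM normcR mulr_gt0 ?normr_gt0 ?gt_eqF // normc_gt0.
    rewrite normcM normcR gtr0_norm //; apply: le_lt_trans z1.
    by rewrite ler_piMl // normc_ge0.
  have szD : normc (s%:C * z) < D.
    rewrite normcM normcR gtr0_norm //.
    by move: sD; rewrite mulrDr mulr1; lra.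
  have sz0 : s%:C * z != 0.
    by rewrite -normc_gt0 normcM normcR mulr_gt0 ?normr_gt0 ?gt_eqF // normc_gt0.
  have := hD (s%:C * z); rewrite normc_lt => /(_ szD).
  rewrite addr0 f0 subr0 !norm_normc -rmorphM lecR.
  have -> : f (s%:C * z) - l * (s%:C * z) = (g (s%:C * z) - l) * (s%:C * z).
    by rewrite /g mulrBl divfK.
  by rewrite normcM ler_pM2r // normc_gt0.
split.
  have h12 : (1 / 2)%:C != 0 :> R[i] by apply/eqP => /complexI; lra.
  have n12 : normc ((1 / 2)%:C : R[i]) < 1 by rewrite normcR gtr0_norm; lra.
  by rewrite -(gE _ h12 n12) g1.
move=> z z1; have [->|z0] := eqVneq z 0; first by rewrite f0 mulr0.
by rewrite -(gE z z0 z1) /g divfK.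
Qed.

Lemma moebius_disc_automorphism lam al : normc lam = 1 -> normc al < 1 ->
  disc_automorphism (moebius lam al).
Proof.
move=> l1 a1; split.
- move=> z z1; apply: ex_derive; apply: is_derive_moebius.
  by apply: moebius_den_neq0 => //; exact: ltW.
- by move=> z; exact: normc_moebius_lt1.
- move=> z w z1 w1 e.
  by rewrite -(moebiusK l1 a1 (ltW z1)) e moebiusK // ltW.
- move=> w w1; exists (moebius lam^* (- (lam * al)) w); last first.
    by rewrite moebiusKV // ltW.
  by apply: normc_moebius_lt1; rewrite ?normc_conj ?normc_mul_unimodular.
Qed.

Lemma disc_automorphism_comp (f g : C -> C) :
  disc_automorphism f -> disc_automorphism g -> disc_automorphism (g \o f).
Proof.
move=> [df f1 fi fs] [dg g1 gi gs]; split.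
- move=> z z1; apply: derivable_compC; first exact: df.
  by apply: dg; exact: f1.
- by move=> z z1; apply: g1; exact: f1.
- move=> z w z1 w1 /gi h; apply: fi => //; apply: h; exact: f1.
- move=> w /gs[v /fs[z z1 <-] <-]; by exists z.
Qed.

(** With f'(a) nonzero, S sending 0 to a and T sending f a to 0, the map T o f o S fixes 0 with
    nonzero derivative. It is thus a rotation, and f is a composition of Moebius maps. *)
Theorem disc_automorphism_moebius (f : C -> C) : disc_automorphism f ->
  exists lam, exists al, [/\ normc lam = 1, normc al < 1 &
    forall z, normc z < 1 -> f z = moebius lam al z].
Proof.
move=> fA; have [df f1 finj fsurj] := fA.
have [a a1 l0] : exists2 a, normc a < 1 & 'D_1 f a != 0.
  (* If the derivative vanished on the whole disc, f would agree at 0 and 1 / 2, against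
     injectivity. *)
  apply: contrapT => /forall2NP h.
  have /finj : f (1 / 2)%:C = f 0.
    apply: zero_derive_segment => t /andP[t0 t1].
    rewrite add0r subr0 -rmorphM.
    have n1 : normc ((t * (1 / 2))%:C : R[i]) < 1.
      by rewrite normcR ger0_norm; lra.
    have := df _ n1 => /derivableP.
    by case: (h (t * (1 / 2))%:C) => // /negP; rewrite negbK => /eqP ->.
  rewrite normcR normc0 gtr0_norm ?divr_gt0 // => h2.
  have : (1 / 2)%:C = 0 :> R[i] by apply: h2; lra.
  by move=> /complexI; lra.
set l := 'D_1 f a in l0.
have dl : is_derive (a : C) 1 f l by apply: derivableP; exact: df.
pose b := f a; have b1 : normc b < 1 := f1 a a1.
have na1 : normc (- a) < 1 by rewrite normcN.
have n1 := normc1 R.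
pose S : C -> C := moebius 1 (- a).
pose T : C -> C := moebius 1 b.
have S0 : S 0 = a by rewrite /S /moebius mulr0 subr0 divr1 mul1r sub0r opprK.
have SA : disc_automorphism S := moebius_disc_automorphism n1 na1.
have TA : disc_automorphism T := moebius_disc_automorphism n1 b1.
have FA := disc_automorphism_comp (disc_automorphism_comp SA fA) TA.
have F0 : (T \o (f \o S)) 0 = 0.
  by rewrite /= S0 /T /moebius subrr mulr0 mul0r.
have dS := @is_derive_moebius R 1 (- a) 0 (moebius_den_neq0 na1 _).
have {}dS := dS _; rewrite normc0 ler01 in dS; have {}dS := dS isT.
set lS := (X in is_derive _ _ _ X) in dS.
have lS0 : lS != 0.
  rewrite /lS !mulf_neq0 ?oner_eq0 ?defect_neq0 // invr_neq0 // expf_neq0 //.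
  by rewrite moebius_den_neq0 // normc0 ler01.
have dT := @is_derive_moebius R 1 b b (moebius_den_neq0 b1 (ltW b1)).
set lT := (X in is_derive _ _ _ X) in dT.
have lT0 : lT != 0.
  rewrite /lT !mulf_neq0 ?oner_eq0 ?defect_neq0 // invr_neq0 // expf_neq0 //.
  by rewrite moebius_den_neq0 // ltW.
have dF : is_derive (0 : C) 1 (T \o (f \o S)) (lT * (l * lS)).
  have dfS : is_derive (0 : C) 1 (f \o S) (l * lS).
    have dl' : is_derive (S 0) 1 f l by rewrite S0.
    exact: (is_derive_comp_field dS dl').
  have dT' : is_derive (f (S 0)) 1 T lT by rewrite S0.
  exact: (is_derive_comp_field dfS dT').
have [|c1 cE] := disc_automorphism_fix0 FA F0 dF.
  exact: (mulf_neq0 lT0 (mulf_neq0 l0 lS0)).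
set c := lT * (l * lS) in c1 cE.
(* The identity T (f (S u)) = c u is taken at u = [moebius 1 a z] and solved for f z; the factor c
   joins the inner map. *)
have fE z : normc z < 1 -> f z = moebius 1 (- b) (moebius c a z).
  move=> z1; have := cE (moebius 1 a z) (normc_moebius_lt1 n1 a1 z1).
  have SK := @moebiusK R 1 a z n1 a1 (ltW z1).
  rewrite conjc1 mul1r in SK.
  rewrite /= /S SK.
  have TK := @moebiusK R 1 b (f z) n1 b1 (ltW (f1 z z1)).
  rewrite conjc1 mul1r in TK.
  rewrite -{2}TK -/T => ->; congr (moebius _ _ _).
  by rewrite /moebius mul1r mulrA.
have nb1 : normc (- b) < 1 by rewrite normcN.
have [lam [al [lam1 al1 h]]] := moebius_comp n1 nb1 c1 a1.
by exists lam, al; split=> // z z1; rewrite fE // h // ltW.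
Qed.

End DiscAutomorphism.

(** * Multiplicities of roots *)

Lemma derivable_horner_field (K : numFieldType) (p : {poly K}) (x : K^o) :
  derivable (horner p : K^o -> K^o) x 1.
Proof.
elim/poly_ind: p => [|p c IH].
  rewrite (_ : horner 0 = cst 0); first exact: derivable_cst.
  by apply/funext => t; rewrite horner0.
rewrite (_ : horner _ = (horner p : K^o -> K^o) * id + cst (c : K^o)).
  by apply: derivableD => //; apply: derivableM => //; exact: derivable_id.
by apply/funext => t; rewrite hornerMXaddC.
Qed.

Section Multiplicity.
Variable R : realType.
Local Notation C := (R[i]^o).
Implicit Types (p q : {poly R[i]}) (z x : R[i]).

(** If the cofactor e of the gcd in p had a root x, then x would have a larger multiplicity in p
    than in the gcd, although that power of X - x divides both p and q. *)
Lemma dvdp_mup p q : p != 0 -> q != 0 ->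
  (forall x, root p x -> (mup x p <= mup x q)%N) -> p %| q.
Proof.
move=> p0 q0 hpq; set d := gcdp p q.
have dp : d %| p := dvdp_gcdl p q.
have [e pE] := dvdpP _ _ dp.
have e0 : e != 0 by apply: contraNneq p0 => e0; rewrite pE e0 mul0r.
have d0 : d != 0 by rewrite gcdp_eq0 negb_and p0.
have [se|se] := eqVneq (size e) 1%N.
  have ep : p %= d by rewrite pE -{2}[d]mul1r eqp_mul2r // -size_poly_eq1 se.
  by rewrite (eqp_dvdl _ ep) dvdp_gcdr.
have [x ex] := closed_rootP e se.
have px : root p x by rewrite pE rootM ex.
have : (mup x p <= mup x d)%N.
  by rewrite mup_geq // dvdp_gcd -!mup_geq // leqnn hpq.
rewrite {1}pE mupM // -[X in (_ <= X)%N]add0n leq_add2r leqn0 => /eqP m0.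
by have := XsubC_dvd x e0; rewrite m0 dvdp_XsubCl ex.
Qed.

(** After division by (z - x)^m, a larger order of q at x would give |p1 z| <= M |z - x| |q1 z| with
    p1 x nonzero, which fails as z tends to x along the radius. *)
Lemma mup_le_of_bound p q (M : R) x : p != 0 -> q != 0 -> normc x = 1 ->
  (forall z, normc z < 1 -> normc p.[z] <= M * normc q.[z]) ->
  (mup x q <= mup x p)%N.
Proof.
move=> p0 q0 x1 hb; rewrite leqNgt; apply/negP => lt.
have [m [p1 px pE]] := multiplicity_XsubC p x.
rewrite p0 /= in px.
have mE : mup x p = m by rewrite pE mupMr // mup_XsubCX eqxx.
have : ('X - x%:P) ^+ m.+1 %| q by rewrite -mup_geq // -mE.
move=> /dvdpP[q1 qE].
have {}hb z : normc z < 1 -> normc p1.[z] <= M * (normc (z - x) * normc q1.[z]).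
  move=> z1; have := hb z z1; rewrite pE qE !hornerM !horner_exp !hornerXsubC.
  have zx : z - x != 0.
    by rewrite subr_eq0; apply/eqP => h; move: z1; rewrite h x1 ltxx.
  rewrite exprS !normcM.
  have -> : M * (normc q1.[z] * (normc (z - x) * normc ((z - x) ^+ m)))
    = M * (normc (z - x) * normc q1.[z]) * normc ((z - x) ^+ m) by ring.
  by rewrite ler_pM2r // normc_gt0 expf_neq0.
have c0 : 0 < normc p1.[x] by rewrite normc_gt0.
have [D1 D10 h1] := derivable_local_bound
  (@derivable_horner_field _ p1 x) (divr_gt0 c0 (ltr0Sn _ 1)).
have [D2 D20 h2] := derivable_local_bound (@derivable_horner_field _ q1 x) (@ltr01 R).
pose K := `|M| * (normc q1.[x] + 1) + 1.
have K0 : 0 < K by rewrite ltr_wpDl // mulr_ge0 // addr_ge0 ?normc_ge0.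
(* [s] is the distance from x: within both continuity radii, below 1, and with s K < |p1 x| / 2. *)
pose s := Num.min (Num.min D1 D2) (Num.min 1 (normc p1.[x] / 2 / K)) / 2.
have m0 : 0 < Num.min (Num.min D1 D2) (Num.min 1 (normc p1.[x] / 2 / K)).
  by rewrite !lt_min D10 D20 ltr01 !divr_gt0.
have s0 : 0 < s by rewrite divr_gt0.
have : s < Num.min (Num.min D1 D2) (Num.min 1 (normc p1.[x] / 2 / K)).
  by rewrite /s ltr_pdivrMr // ltr_pMr // ltr1n.
rewrite !lt_min => /andP[/andP[sD1 sD2] /andP[s1 sK]].
pose h : R[i] := - (s%:C * x).
have nh : normc h = s by rewrite normcN normcM normcR x1 mulr1 gtr0_norm.
have hx : normc (h + x) < 1.
  have -> : h + x = (1 - s)%:C * x by rewrite /h rmorphB /=; ring.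
  by rewrite normcM normcR x1 mulr1 gtr0_norm; lra.
have := hb _ hx; rewrite addrK nh.
have {h1} := h1 h; rewrite normc_lt nh normc_le => /(_ sD1) h1.
have {h2} := h2 h; rewrite normc_lt nh normc_le => /(_ sD2) h2.
have {}h1 : normc p1.[x] / 2 <= normc p1.[h + x].
  by have := le_normc_sub p1.[x] p1.[h + x]; rewrite normcB; lra.
have {}h2 : normc q1.[h + x] <= normc q1.[x] + 1.
  by have := le_normc_sub q1.[h + x] q1.[x]; lra.
move=> h3; have := le_trans h1 h3; rewrite leNgt => /negP; apply.
apply: (@le_lt_trans _ _ (s * K)); last by rewrite -ltr_pdivlMr.
apply: (@le_trans _ _ (`|M| * (s * (normc q1.[x] + 1)))).
  apply: le_trans (ler_norm _) _; rewrite normrM ler_wpM2l //.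
  rewrite ger0_norm; last by rewrite mulr_ge0 ?normc_ge0 // ltW.
  by rewrite ler_pM2l.
by rewrite mulrCA ler_pM2l // /K lerDl.
Qed.

Definition roots_poly (k : nat) (w : 'I_k -> R[i]) (n : 'I_k -> nat) : {poly R[i]} :=
  \prod_(j < k) ('X - (w j)%:P) ^+ n j.

Lemma monic_roots_poly k w n : @roots_poly k w n \is monic.
Proof. by apply: rpred_prod => j _; rewrite monic_exp // monicXsubC. Qed.

Lemma roots_poly_neq0 k w n : @roots_poly k w n != 0.
Proof. exact/monic_neq0/monic_roots_poly. Qed.

Lemma horner_roots_poly k w n x :
  (@roots_poly k w n).[x] = \prod_(j < k) (x - w j) ^+ n j.
Proof.
by rewrite horner_prod; apply: eq_bigr => j _; rewrite horner_exp hornerXsubC.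
Qed.

Lemma size_roots_poly k w w' n :
  size (@roots_poly k w n) = size (@roots_poly k w' n).
Proof.
rewrite !size_prod => [|j _|j _]; try by rewrite expf_neq0 // polyXsubC_eq0.
by congr (_ - _)%N; congr (_.+1); apply: eq_bigr => j _; rewrite !size_exp_XsubC.
Qed.

(** The w j may repeat, so every exponent n j with w j = x contributes. *)
Lemma mup_roots_poly k w n x :
  mup x (@roots_poly k w n) = (\sum_(j < k) (if w j == x then n j else 0))%N.
Proof.
rewrite /roots_poly; elim: (index_enum _) => [|j s IH].
  by rewrite !big_nil mupNroot // root1.
rewrite !big_cons mupM ?IH ?mup_XsubCX //.
  by rewrite expf_neq0 // polyXsubC_eq0.
by rewrite prodf_seq_neq0; apply/allP => i _; rewrite expf_neq0 // polyXsubC_eq0.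
Qed.

(** The inequalities at the roots give divisibility, and both polynomials are monic of the same
    degree. *)
Lemma roots_poly_eq k w w' n :
  (forall j, (mup (w j) (@roots_poly k w n) <= mup (w j) (@roots_poly k w' n))%N) ->
  roots_poly w n = roots_poly w' n.
Proof.
move=> h; apply/eqP; rewrite -eqp_monic ?monic_roots_poly //.
rewrite -dvdp_size_eqp; first by rewrite (size_roots_poly w w').
apply: dvdp_mup; rewrite ?roots_poly_neq0 // => x rx.
have [j /eqP <- //|hj] := pickP (fun j => w j == x).
by rewrite mup_roots_poly big1 // => j _; rewrite hj.
Qed.

End Multiplicity.

(** * The composition operator *)

Section Composition.
Variable R : realType.
Local Notation C := (R[i]^o).
Implicit Types (z w : R[i]) (phi sigma : disc R -> disc R).

Local Notation "z ^*" := (conjc z) : ring_scope.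

Definition to_disc z (h : normc z < 1) : disc R :=
  exist (fun t : C => `|t| < 1) z (etrans (normc_lt z 1) h).

Lemma disc_lt1 (z : disc R) : normc (val z) < 1.
Proof. by rewrite -normc_lt; exact: valP z. Qed.

Lemma AutD_moebius phi : AutD phi ->
  exists lam, exists al, [/\ normc lam = 1, normc al < 1 &
    forall z : disc R, val (phi z) = moebius lam al (val z)].
Proof.
move=> [[psi psiK phiK] [f df fE]].
have fv z (h : normc z < 1) : f z = val (phi (to_disc h)) by rewrite fE.
have fA : disc_automorphism f.
  split.
  - by move=> z; rewrite -normc_lt; exact: df.
  - by move=> z z1; rewrite (fv z z1) disc_lt1.
  - move=> z w z1 w1; rewrite (fv z z1) (fv w w1) => /val_inj e.
    by have := congr1 (fun t => val (psi t)) e; rewrite !psiK.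
  - move=> w w1; exists (val (psi (to_disc w1))); first exact: disc_lt1.
    by rewrite -fE phiK.
have [lam [al [l1 a1 h]]] := disc_automorphism_moebius fA.
exists lam, al; split=> // z; rewrite fE h //; exact: disc_lt1.
Qed.

Lemma derivable_agree_on_circle (f g : C -> C) w : normc w = 1 ->
  derivable f w 1 -> derivable g w 1 ->
  (forall z, normc z < 1 -> f z = g z) -> f w = g w.
Proof.
move=> w1 df dg fg; apply/eqP; rewrite -subr_eq0 -normc_eq0 eq_le normc_ge0 andbT.
apply/ler_addgt0Pr => e e0; rewrite add0r.
have e20 : 0 < e / 2 by rewrite divr_gt0.
have [D1 D10 h1] := derivable_local_bound df e20.
have [D2 D20 h2] := derivable_local_bound dg e20.
pose s := Num.min (Num.min D1 D2) 1 / 2.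
have m0 : 0 < Num.min (Num.min D1 D2) 1 by rewrite !lt_min D10 D20 ltr01.
have s0 : 0 < s by rewrite divr_gt0.
have : s < Num.min (Num.min D1 D2) 1 by rewrite /s ltr_pdivrMr // ltr_pMr // ltr1n.
rewrite !lt_min => /andP[/andP[sD1 sD2] s1].
pose h : R[i] := - (s%:C * w).
have nh : normc h = s by rewrite normcN normcM normcR w1 mulr1 gtr0_norm.
have hw : normc (h + w) < 1.
  have -> : h + w = (1 - s)%:C * w by rewrite /h rmorphB /=; ring.
  by rewrite normcM normcR w1 mulr1 gtr0_norm; lra.
have {h1} := h1 h; rewrite normc_lt nh normc_le => /(_ sD1) h1.
have {h2} := h2 h; rewrite normc_lt nh normc_le => /(_ sD2) h2.
rewrite (fg _ hw) in h1.
have -> : f w - g w = (g (h + w) - g w) - (g (h + w) - f w).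
  by rewrite opprB [RHS]addrC addrA subrK.
by apply: le_trans (le_normcB _ _) _; lra.
Qed.

(** The Moebius formula is analytic where its denominator is nonzero, so an extension exists; the
    chosen one agrees with the formula on the disc, hence by continuity on the circle. *)
Lemma extendE phi lam al w : normc al < 1 -> normc lam = 1 ->
  (forall z : disc R, val (phi z) = moebius lam al (val z)) ->
  normc w = 1 -> extend phi w = moebius lam al w.
Proof.
move=> a1 l1 phiE w1.
have : analytic_extension phi (extend phi).
  apply: (@getPex _ [set g | analytic_extension phi g]).
  exists (moebius lam al); split; last by move=> z; rewrite phiE.
  exists [set z : C | 1 - al^* * z != 0]; split.
  - rewrite openE => z /= z0.
    have dD : derivable (fun t : C => 1 - al^* * t : C) z 1.
      apply: derivableB; first exact: derivable_cst.
      by apply: derivableM; [exact: derivable_cst|exact: derivable_id].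
    have n0 : 0 < normc (1 - al^* * z) by rewrite normc_gt0.
    have [D D0 hD] := derivable_local_bound dD (divr_gt0 n0 (ltr0Sn _ 1)).
    apply/nbhs_ballP; exists D%:C; first by rewrite /= ltcR.
    move=> t; rewrite -ball_normE /= -normrN opprB => /hD.
    rewrite subrK normc_le => h; rewrite -normc_gt0.
    by have := le_normc_sub (1 - al^* * z) (1 - al^* * t); rewrite normcB; lra.
  - by move=> z /=; rewrite normc_le; exact: moebius_den_neq0.
  - by move=> z /= z0; apply: ex_derive; exact: is_derive_moebius.
move=> [[U [oU DU dU]] eU]; apply: derivable_agree_on_circle => //.
- by apply: dU; apply: DU => /=; rewrite normc_le w1.
- by apply: ex_derive; apply: is_derive_moebius; rewrite moebius_den_neq0 ?w1.
- by move=> z z1; have := eU (to_disc z1); rewrite phiE.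
Qed.

(** A bound in [R[i]] is real and nonnegative as soon as it dominates one modulus, here the one at
    0. *)
Lemma Hinfty_bound (f : disc R -> C) : Hinfty f ->
  exists2 M : R, 0 <= M & forall z : disc R, normc (f z) <= M.
Proof.
move=> [_ [M hM]].
have h0 : normc (0 : R[i]) < 1 by rewrite normc0.
have := le_trans (normr_ge0 _) (hM (to_disc h0)).
case: M hM => a b hM; rewrite lecE /= => /andP[/eqP b0 a0].
exists a => // z; rewrite -normc_le; have := hM z; rewrite b0.
exact.
Qed.

(** Used with [sigma] equal to phi and to its inverse, for the image and for the preimage under
    composition with phi. *)
Lemma Hinfty_mul_comp (f : disc R -> C) (u : C -> C) sigma lam al (B : R) :
  normc lam = 1 -> normc al < 1 ->
  (forall z : disc R, val (sigma z) = moebius lam al (val z)) ->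
  (forall z, normc z < 1 -> derivable u z 1) ->
  (forall z, normc z < 1 -> normc (u z) <= B) ->
  Hinfty f -> Hinfty (fun z : disc R => (u (val z) : R[i]) * f (sigma z)).
Proof.
move=> l1 a1 sE du uB hf; split; last first.
  have [M M0 hM] := Hinfty_bound hf.
  exists (B * M)%:C => z; rewrite normc_le normcM.
  apply: ler_pM; rewrite ?normc_ge0 ?hM //; apply: uB; exact: disc_lt1.
have [[g dg gE] _] := hf.
exists (fun z : C => (u z : R[i]) * g (moebius lam al z)) => /=; last first.
  by move=> z; rewrite gE sE.
move=> z /=; rewrite normc_lt => z1.
pose T : C -> C := moebius lam al.
have dm : derivable (g \o T) z 1.
  apply: derivable_compC; last by apply: dg; rewrite /= normc_lt normc_moebius_lt1.
  apply: ex_derive; apply: is_derive_moebius.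
  by apply: moebius_den_neq0 => //; exact: ltW.
exact: derivableM (du z z1) dm.
Qed.

Lemma derivable_moebius_den al z n (K : R[i]) :
  derivable (fun t : C => K * (1 - al^* * t) ^+ n : C) z 1.
Proof.
apply: derivableM; first exact: derivable_cst.
apply: derivable_expr_field.
apply: derivableB; first exact: derivable_cst.
by apply: derivableM; [exact: derivable_cst|exact: derivable_id].
Qed.

(** Each root is the image of a point v j of the circle, and [moebius_sub] rewrites g z - g (v j) as
    a constant times (z - v j) / (1 - conj al z). [K] collects the constants. *)
Lemma roots_poly_moebius lam al k (w : 'I_k -> R[i]) (n : 'I_k -> nat) :
  normc lam = 1 -> normc al < 1 -> (forall j, normc (w j) = 1) ->
  exists2 K, K != 0 & forall z, normc z <= 1 ->
    (roots_poly w n).[moebius lam al z]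
    = K * (roots_poly (fun j => moebius lam^* (- (lam * al)) (w j)) n).[z]
      / (1 - al^* * z) ^+ (\sum_(j < k) n j).
Proof.
move=> l1 a1 w1.
pose v j := moebius lam^* (- (lam * al)) (w j).
have v1 j : normc (v j) = 1.
  by rewrite normc_moebius_eq1 ?normc_conj ?normc_mul_unimodular.
have vw j : w j = moebius lam al (v j) by rewrite moebiusKV ?w1.
have E0 j : 1 - al^* * v j != 0 by rewrite moebius_den_neq0 ?v1.
exists (\prod_(j < k) (lam * (1 - al * al^*) / (1 - al^* * v j)) ^+ n j).
  rewrite prodf_seq_neq0; apply/allP => j _; apply: expf_neq0.
  apply: mulf_neq0; last by rewrite invr_neq0.
  exact: mulf_neq0 (unimodular_neq0 l1) (defect_neq0 a1).
move=> z z1; have Ez := moebius_den_neq0 a1 z1.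
rewrite -prodrXr -prodfV !horner_roots_poly -!big_split /=.
apply: eq_bigr => j _; rewrite {1}vw moebius_sub ?v1 //.
rewrite -exprVn -!exprMn; congr (_ ^+ _).
by rewrite -/(v j); field; rewrite Ez E0.
Qed.

Lemma mup_roots_poly_moebius lam al k (w : 'I_k -> R[i]) (n : 'I_k -> nat) z :
  normc lam = 1 -> normc al < 1 -> (forall j, normc (w j) = 1) ->
  normc z = 1 ->
  mup z (roots_poly (fun j => moebius lam^* (- (lam * al)) (w j)) n)
  = mup (moebius lam al z) (roots_poly w n).
Proof.
move=> l1 a1 w1 z1; rewrite !mup_roots_poly; apply: eq_bigr => j _.
suff -> : (moebius lam^* (- (lam * al)) (w j) == z) = (w j == moebius lam al z) by [].
by apply/eqP/eqP => [<-|->]; rewrite ?moebiusK ?moebiusKV ?w1 ?z1.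
Qed.

End Composition.

(** * The two implications *)

Section CompositionOperator.
Variable R : realType.
Local Notation C := (R[i]^o).
Implicit Types (z : R[i]) (phi sigma : disc R -> disc R).

Local Notation "z ^*" := (conjc z) : ring_scope.

Lemma Hinfty1 : Hinfty (fun _ : disc R => 1 : C).
Proof.
split; last by exists 1 => z; rewrite normr1.
by exists (fun=> 1) => // z _; exact: derivable_cst.
Qed.

Lemma moebius_den_expr_bounds al z N : normc al < 1 -> normc z <= 1 ->
  (1 - normc al) ^+ N <= normc (1 - al^* * z) ^+ N /\
  normc (1 - al^* * z) ^+ N <= 2 ^+ N.
Proof.
move=> a1 z1; have h := moebius_den_bound al z1; split.
  by rewrite lerXn2r ?nnegrE ?normc_ge0 // subr_ge0 ltW.
rewrite lerXn2r ?nnegrE ?normc_ge0 //.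
apply: le_trans (le_normcB _ _) _.
have : normc al * normc z <= 1 * 1.
  by apply: ler_pM; rewrite ?normc_ge0 // ltW.
by rewrite normc1 normcM normc_conj; lra.
Qed.

(** Equal multiplicities make the transported polynomial equal to the original one, so composition
    with phi multiplies it by K / (1 - conj al z)^N, which is bounded above and away from 0. *)
Lemma roots_poly_preserved phi lam al k (w : 'I_k -> R[i]) (n : 'I_k -> nat) :
  bijective phi -> normc lam = 1 -> normc al < 1 ->
  (forall z : disc R, val (phi z) = moebius lam al (val z)) ->
  (forall j, normc (w j) = 1) ->
  (forall j, mup (moebius lam al (w j)) (roots_poly w n)
    = mup (w j) (roots_poly w n)) ->
  algebra_automorphism (mul_Hinfty (roots_poly w n)) (comp_op phi).
Proof.
move=> [psi psiK phiK] l1 a1 phiE w1 hm.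
have QE : roots_poly w n
    = roots_poly (fun j => moebius lam^* (- (lam * al)) (w j)) n.
  apply: (@roots_poly_eq R k w _ n) => j.
  by rewrite (mup_roots_poly_moebius n l1 a1 w1 (w1 j)) hm.
have [K K0] := roots_poly_moebius n l1 a1 w1; rewrite -QE.
set N := (\sum_(j < k) n j)%N => KE.
have nK0 : 0 < normc K by rewrite normc_gt0.
have E0 (z : disc R) : 1 - al^* * val z != 0.
  by apply: moebius_den_neq0 => //; exact/ltW/disc_lt1.
have psiE (z : disc R) :
    val (psi z) = moebius lam^* (- (lam * al)) (val z).
  rewrite -{2}[z]phiK phiE moebiusK //; exact/ltW/disc_lt1.
split => //; split.
- move=> F [f hf FE]; exists (fun z : disc R => K / (1 - al^* * val z) ^+ N * f (phi z)).
    apply: (@Hinfty_mul_comp R f (fun z => K / (1 - al^* * z) ^+ N) phi lam al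
      (normc K / (1 - normc al) ^+ N)) => // z z1.
      apply: derivable_div_field; last 2 first.
      - exact: derivable_cst.
      - have := @derivable_moebius_den R al z N 1.
        by under eq_fun do rewrite mul1r.
      by rewrite expf_neq0 // moebius_den_neq0 // ltW.
    rewrite normcM normcV ler_pM2l // normcX.
    have [h _] := moebius_den_expr_bounds N a1 (ltW z1).
    have p0 : 0 < (1 - normc al) ^+ N by rewrite exprn_gt0 // subr_gt0.
    by rewrite lef_pV2 ?posrE //; exact: lt_le_trans h.
  move=> z; rewrite /comp_op /= FE phiE KE; last exact/ltW/disc_lt1.
  rewrite mulrA; congr (_ * _).
  by rewrite mulrAC mulrC mulrA.
- move=> F G _ _ e; apply/funext => z.
  by rewrite -(phiK z); exact: (congr1 (fun H => H (psi z)) e).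
- move=> F [f hf FE].
  (* The preimage: f divided by that factor, then carried back by [psi], which here is the inverse
     of phi. *)
  pose h (z : disc R) : C := K^-1 * (1 - al^* * val (psi z)) ^+ N * f (psi z).
  exists (fun z : disc R => (roots_poly w n).[val z] * h z); last first.
    apply/funext => z; rewrite /comp_op /= FE /h psiK phiE KE; last first.
      exact/ltW/disc_lt1.
    have := expf_neq0 N (E0 z); move: (_ ^+ N) => E En0.
    move: (_.[_]) (f z) => a b.
    transitivity ((K / K) * (E / E) * (a * b)); first by ring.
    by rewrite !divff // !mul1r.
  exists h => //.
  have hE : h = (fun z : disc R => (fun t : C => K^-1 *
      (1 - al^* * moebius lam^* (- (lam * al)) t) ^+ N : C) (val z) * f (psi z)).
    by apply/funext => z; rewrite /h psiE.
  rewrite hE.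
  have l1' : normc lam^* = 1 by rewrite normc_conj.
  have a1' : normc (- (lam * al)) < 1 by rewrite normc_mul_unimodular.
  apply: (@Hinfty_mul_comp R f (fun t : C => K^-1 *
      (1 - al^* * moebius lam^* (- (lam * al)) t) ^+ N) psi lam^*
      (- (lam * al)) (normc K^-1 * 2 ^+ N)) => // z z1.
    pose T : C -> C := moebius lam^* (- (lam * al)).
    apply: (@derivable_compC R T (fun t : C => K^-1 * (1 - al^* * t) ^+ N)).
      apply: ex_derive; apply: is_derive_moebius.
      by apply: moebius_den_neq0 => //; exact: ltW.
    exact: derivable_moebius_den.
  rewrite normcM normcX ler_pM2l; last by rewrite normcV invr_gt0.
  have [_] := moebius_den_expr_bounds N a1
    (normc_moebius_le1 l1' a1' (ltW z1)).
  exact.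
Qed.

(** The polynomial p itself lies in its ideal. Its image and its preimage under composition with phi
    yield the two comparisons between |p| and |q|. *)
Lemma mup_preserved phi lam al k (w : 'I_k -> R[i]) (n : 'I_k -> nat) j :
  normc lam = 1 -> normc al < 1 ->
  (forall z : disc R, val (phi z) = moebius lam al (val z)) ->
  (forall j, normc (w j) = 1) ->
  algebra_automorphism (mul_Hinfty (roots_poly w n)) (comp_op phi) ->
  mup (moebius lam al (w j)) (roots_poly w n) = mup (w j) (roots_poly w n).
Proof.
move=> l1 a1 phiE w1 [[hfun _ hsurj] _ _].
set p := roots_poly w n in hfun hsurj *.
have pA : mul_Hinfty p (fun z : disc R => p.[val z] : C).
  by exists (fun=> 1) => [|z]; [exact: Hinfty1|rewrite mulr1].
have [K K0] := roots_poly_moebius n l1 a1 w1.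
set q := roots_poly (fun i => moebius lam^* (- (lam * al)) (w i)) n.
set N := (\sum_(i < k) n i)%N => KE.
have nK0 : 0 < normc K by rewrite normc_gt0.
rewrite -(mup_roots_poly_moebius n l1 a1 w1 (w1 j)) -/q.
have En0 z : normc z < 1 -> 0 < normc (1 - al^* * z) ^+ N.
  by move=> z1; rewrite exprn_gt0 // normc_gt0 moebius_den_neq0 // ltW.
have nKE z : normc z < 1 ->
    normc p.[moebius lam al z] = normc K * normc q.[z] / normc (1 - al^* * z) ^+ N.
  by move=> z1; rewrite KE ?(ltW z1) // !normcM normcV normcX.
apply/eqP; rewrite eqn_leq; apply/andP; split.
(* Surjectivity: p = F o phi with F = p f, so |p| is at most a constant times |q|. *)
- have [F [f hf FE] TF] := hsurj _ pA.
  have [M M0 hM] := Hinfty_bound hf.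
  apply: (@mup_le_of_bound R p q (M * (normc K / (1 - normc al) ^+ N))) => //.
  + exact: roots_poly_neq0.
  + exact: roots_poly_neq0.
  move=> z z1; have := congr1 (fun H => H (to_disc z1)) TF.
  rewrite /comp_op /= FE phiE /= => <-.
  rewrite normcM nKE // mulrC.
  have -> : M * (normc K / (1 - normc al) ^+ N) * normc q.[z]
    = M * (normc K * normc q.[z] / (1 - normc al) ^+ N) by ring.
  apply: ler_pM => //; rewrite ?normc_ge0 //.
    by rewrite !mulr_ge0 ?normc_ge0 // invr_ge0 ltW // En0.
  rewrite ler_wpM2l ?mulr_ge0 ?normc_ge0 //.
  have [h _] := moebius_den_expr_bounds N a1 (ltW z1).
  have p0 : 0 < (1 - normc al) ^+ N by rewrite exprn_gt0 // subr_gt0.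
  by rewrite lef_pV2 ?posrE // En0.
(* Invariance: p o phi = p f, so |q| is at most a constant times |p|. *)
- have [f hf fE] := hfun _ pA.
  have [M M0 hM] := Hinfty_bound hf.
  apply: (@mup_le_of_bound R q p (M * 2 ^+ N / normc K)) => //.
  + exact: roots_poly_neq0.
  + exact: roots_poly_neq0.
  move=> z z1; have := fE (to_disc z1).
  rewrite /comp_op /= phiE /= => e.
  have := nKE z z1; rewrite e normcM => e'.
  have -> : normc q.[z] = normc p.[z] * normc (f (to_disc z1))
      * normc (1 - al^* * z) ^+ N / normc K.
    by rewrite e'; field; rewrite !gt_eqF ?En0.
  have [_ h] := moebius_den_expr_bounds N a1 (ltW z1).
  have -> : M * 2 ^+ N / normc K * normc p.[z]
    = normc p.[z] * M * 2 ^+ N / normc K by ring.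
  rewrite ler_pM2r ?invr_gt0 //.
  apply: ler_pM; rewrite ?mulr_ge0 ?normc_ge0 ?exprn_ge0 ?normc_ge0 //.
  by rewrite ler_wpM2l ?normc_ge0.
Qed.

End CompositionOperator.

Unset Implicit Arguments.

Theorem theorem5p3 (R : realType) (phi : disc R -> disc R) (k : nat)
    (w : 'I_k -> R[i]) (n : 'I_k -> nat)
    (hphi : AutD phi) (hw : forall j, `|w j| = 1) :
  let psi : {poly R[i]} := \prod_(j < k) ('X - (w j)%:P) ^+ n j in
  algebra_automorphism (mul_Hinfty psi) (comp_op phi) <->
  (forall j : 'I_k, mup (extend phi (w j) : R[i]) psi = mup (w j) psi).
Proof.
move=> psi; rewrite -[psi]/(roots_poly w n).
have w1 j : normc (w j) = 1 by apply: complexI; rewrite -norm_normc hw.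
have [lam [al [l1 a1 phiE]]] := AutD_moebius hphi.
have extE j : extend phi (w j) = moebius lam al (w j) by exact: extendE.
split=> [hA j|hm].
  by rewrite extE; exact: mup_preserved hA.
apply: (roots_poly_preserved _ l1 a1 phiE w1) => [|j]; first by case: hphi.
by rewrite -extE.
Qed.
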